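(* Consider the range space whose ground set is the set of hyperplanes in $\mathbb{R}^d$. Its ranges are indexed by the vertical prisms $\sigma\in\Sigma$, the range of $\sigma$ being the set of hyperplanes that intersect the interior of $\sigma$. The VC-dimension of this range space is at least $1+d(d+1)/2$ and at most $O(d^3)$.
   Context: $\Sigma$ is the family of all vertical prisms in $\mathbb{R}^d$ of the following form. Such a prism is the set of points $x=(x_1,\dots,x_d)$ satisfying, for $i=1,\dots,d$, $$a^-_{i,1}x_1+\dots+a^-_{i,i-1}x_{i-1}+b^-_i\ \le\ x_i\ \le\ a^+_{i,1}x_1+\dots+a^+_{i,i-1}x_{i-1}+b^+_i,$$ for arbitrary real parameters $a^\pm_{i,j}$ and $b^\pm_i$. For $i=1$ this reads $b_1^-\le x_1\le b_1^+$. Any of these $2d$ inequalities may be omitted. A set of hyperplanes is shattered if each of its subsets is the set of its hyperplanes meeting the interior of some prism in $\Sigma$. The VC-dimension is the largest size of a shattered set. *)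

(* Defs.v *)
From Stdlib Require Import Reals.
Open Scope R_scope.

(* A point of R^d is a function nat -> R; only coordinates 0..d-1 matter
   (coordinate i here is x_{i+1} of the paper). *)
Definition point := nat -> R.

Fixpoint pdot (k : nat) (a x : point) : R :=
  match k with
  | O => 0
  | S k' => pdot k' a x + a k' * x k'
  end.

Definition is_hyperplane (d : nat) (H : point -> Prop) : Prop :=
  exists (a : point) (b : R),
    (exists i, (i < d)%nat /\ a i <> 0) /\
    forall x, H x <-> pdot d a x = b.

(* A vertical prism: for each coordinate i < d an optional lower and an optional
   upper constraint, each given by coefficients a (on coordinates j < i) and b:
   lower: sum_{j<i} a_j x_j + b <= x_i ; upper: x_i <= sum_{j<i} a_j x_j + b. *)
Record prism := mkPrism {
  lo : nat -> option (point * R);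
  up : nat -> option (point * R) }.

Definition in_prism (d : nat) (s : prism) (x : point) : Prop :=
  forall i, (i < d)%nat ->
    (match lo s i with
     | Some (a, b) => pdot i a x + b <= x i
     | None => True end) /\
    (match up s i with
     | Some (a, b) => x i <= pdot i a x + b
     | None => True end).

Definition interior (d : nat) (P : point -> Prop) (x : point) : Prop :=
  exists eps, 0 < eps /\
    forall y, (forall i, (i < d)%nat -> Rabs (y i - x i) < eps) -> P y.

Definition meets_interior (d : nat) (H : point -> Prop) (s : prism) : Prop :=
  exists x, H x /\ interior d (in_prism d s) x.

Definition shattered (d n : nat) (H : nat -> point -> Prop) : Prop :=
  (forall i, (i < n)%nat -> is_hyperplane d (H i)) /\
  (forall i j, (i < n)%nat -> (j < n)%nat -> i <> j ->
     ~ (forall x, H i x <-> H j x)) /\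
  (forall S : nat -> bool, exists s : prism,
     forall i, (i < n)%nat -> (meets_interior d (H i) s <-> S i = true)).

(* Main.v *)
(* Lower bound. Index the tests by pairs [(i, j)] with [j <= i < d], plus one extra. The
   prisms are [0 < x_i < c_i - w_i - \sum_(l < i) s_il x_l] with [w_i] in [{0, 1}] and
   [s_il] in [{1, -1}] chosen freely, one binary choice per test. The hyperplane of [(i, j)]
   is the upper envelope over [x >= 0] of all the ceilings of coordinate [i] whose [j]-th
   choice is "no"; a ceiling whose [j]-th choice is "yes" rises above it near [x = e_j] (near
   [x = 0] for [j = i]). The extra hyperplane, where the last coordinate is [-1], is met iff
   the last lower bound is omitted.

   Upper bound. The open prism meets a hyperplane iff it contains points strictly on both
   sides of it, i.e. iff two homogeneous systems of [k = 2d + 2] strict linear inequalities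
   are feasible. By Gordan's theorem and a minimal-support argument, feasibility is determined
   by the signs of the determinants and adjugate entries of the [2 ^ k] principal Gram
   matrices of the system: [2 ^ O(d)] polynomials of degree [O(d)] in [m = O(d ^ 2)]
   coefficients of the prism. A Warren-type bound, (number of polynomials * degree) ^ O(m), on
   the number of sign patterns gives [2 ^ n <= (n 2 ^ O(d)) ^ O(d ^ 2)], so [n = O(d ^ 3)]. *)
Require Import Defs.
From Stdlib Require Import Reals Arith Lra Lia.
From mathcomp Require all_boot all_order all_algebra.
From mathcomp Require all_classical reals topology normedtype derive.
From mathcomp Require ring lra zify Rstruct.

(** * Open prisms *)

Lemma pdot_ext (k : nat) (a x y : point) :
  (forall j, (j < k)%nat -> x j = y j) -> pdot k a x = pdot k a y.
Proof.
  induction k as [|k IH]; intros E; simpl; [reflexivity|].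
  rewrite E, IH by auto with arith. reflexivity.
Qed.

Lemma pdot_segment (k : nat) (a x y : point) (t : R) :
  pdot k a (fun j => x j + t * (y j - x j)) = pdot k a x + t * (pdot k a y - pdot k a x).
Proof. induction k as [|k IH]; simpl; [ring|]. rewrite IH. ring. Qed.

Lemma pdot_sub (k : nat) (a b x : point) :
  pdot k (fun j => a j - b j) x = pdot k a x - pdot k b x.
Proof. induction k as [|k IH]; simpl; [ring|]. rewrite IH. ring. Qed.

Lemma pdot_le (k : nat) (a b x : point) :
  (forall j, (j < k)%nat -> a j * x j <= b j * x j) -> pdot k a x <= pdot k b x.
Proof.
  induction k as [|k IH]; intros L; simpl; [lra|].
  pose proof (L k (Nat.lt_succ_diag_r k)).
  assert (pdot k a x <= pdot k b x) by (apply IH; auto with arith). lra.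
Qed.

Definition shift (x : point) (i : nat) (t : R) : point :=
  fun j => if j =? i then x j + t else x j.

Lemma pdot_shift (k i : nat) (a x : point) (t : R) :
  pdot k a (shift x i t) = pdot k a x + (if i <? k then a i * t else 0).
Proof.
  induction k as [|k IH]; simpl pdot; [simpl; ring|].
  rewrite IH. unfold shift.
  destruct (Nat.eqb_spec k i), (Nat.ltb_spec i k), (Nat.ltb_spec i (S k));
    try lia; subst; ring.
Qed.

Lemma pdot_continuous (k : nat) (a x : point) (e : R) : 0 < e ->
  exists r, 0 < r /\ forall y, (forall j, (j < k)%nat -> Rabs (y j - x j) < r) ->
    Rabs (pdot k a y - pdot k a x) < e.
Proof.
  revert e; induction k as [|k IH]; intros e He; simpl.
  - exists 1. split; [lra|]. intros y _. rewrite Rminus_diag, Rabs_R0. exact He.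
  - destruct (IH (e / 2)) as [r [Hr HP]]; [lra|].
    assert (Ha : 0 < Rabs (a k) + 1) by (pose proof (Rabs_pos (a k)); lra).
    assert (Hq : 0 < e / 2 / (Rabs (a k) + 1)) by (apply Rdiv_lt_0_compat; lra).
    exists (Rmin r (e / 2 / (Rabs (a k) + 1))). split; [now apply Rmin_glb_lt|].
    intros y Hy.
    replace (pdot k a y + a k * y k - (pdot k a x + a k * x k))
      with ((pdot k a y - pdot k a x) + a k * (y k - x k)) by ring.
    eapply Rle_lt_trans; [apply Rabs_triang|].
    assert (H1 : Rabs (pdot k a y - pdot k a x) < e / 2).
    { apply HP. intros j Hj. eapply Rlt_le_trans; [apply Hy; lia|apply Rmin_l]. }
    assert (H2 : Rabs (y k - x k) < e / 2 / (Rabs (a k) + 1)).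
    { eapply Rlt_le_trans; [apply Hy; lia|apply Rmin_r]. }
    rewrite Rabs_mult.
    assert (H3 : (Rabs (a k) + 1) * Rabs (y k - x k) < e / 2).
    { apply Rmult_lt_compat_l with (r := Rabs (a k) + 1) in H2; [|exact Ha].
      replace ((Rabs (a k) + 1) * (e / 2 / (Rabs (a k) + 1))) with (e / 2) in H2
        by (field; lra). exact H2. }
    pose proof (Rabs_pos (y k - x k)). nra.
Qed.

Definition in_open_prism (d : nat) (s : prism) (x : point) : Prop :=
  forall i, (i < d)%nat ->
    (match lo s i with
     | Some (a, b) => pdot i a x + b < x i
     | None => True end) /\
    (match Defs.up s i with
     | Some (a, b) => x i < pdot i a x + b
     | None => True end).

Lemma uniform_radius (d : nat) (P : nat -> R -> Prop) :
  (forall i r r', P i r -> 0 < r' <= r -> P i r') ->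
  (forall i, (i < d)%nat -> exists r, 0 < r /\ P i r) ->
  exists r, 0 < r /\ forall i, (i < d)%nat -> P i r.
Proof.
  intros mono. induction d as [|d IH]; intros HP.
  - exists 1. split; [lra|]. intros; lia.
  - destruct IH as [r [Hr H]]; [auto with arith|].
    destruct (HP d) as [r' [Hr' H']]; [lia|].
    assert (0 < Rmin r r') by now apply Rmin_glb_lt.
    exists (Rmin r r'). split; [assumption|]. intros i Hi.
    destruct (Nat.eq_dec i d) as [->|].
    + apply (mono d r'); [assumption|split; [assumption|apply Rmin_r]].
    + apply (mono i r); [apply H; lia|split; [assumption|apply Rmin_l]].
Qed.

Lemma lower_radius (i d : nat) (a x : point) (b : R) :
  (i < d)%nat -> pdot i a x + b < x i ->
  exists r, 0 < r /\ forall y, (forall j, (j < d)%nat -> Rabs (y j - x j) < r) ->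
    pdot i a y + b <= y i.
Proof.
  intros Hi L. destruct (pdot_continuous i a x ((x i - pdot i a x - b) / 2)) as [r [Hr HP]]; [lra|].
  exists (Rmin r ((x i - pdot i a x - b) / 2)).
  split; [apply Rmin_glb_lt; lra|]. intros y Hy.
  assert (H1 : Rabs (pdot i a y - pdot i a x) < (x i - pdot i a x - b) / 2).
  { apply HP. intros j Hj. eapply Rlt_le_trans; [apply Hy; lia|apply Rmin_l]. }
  assert (H2 : Rabs (y i - x i) < (x i - pdot i a x - b) / 2).
  { eapply Rlt_le_trans; [apply Hy; lia|apply Rmin_r]. }
  apply Rabs_def2 in H1, H2. lra.
Qed.

Lemma upper_radius (i d : nat) (a x : point) (b : R) :
  (i < d)%nat -> x i < pdot i a x + b ->
  exists r, 0 < r /\ forall y, (forall j, (j < d)%nat -> Rabs (y j - x j) < r) ->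
    y i <= pdot i a y + b.
Proof.
  intros Hi L. destruct (pdot_continuous i a x ((pdot i a x + b - x i) / 2)) as [r [Hr HP]]; [lra|].
  exists (Rmin r ((pdot i a x + b - x i) / 2)).
  split; [apply Rmin_glb_lt; lra|]. intros y Hy.
  assert (H1 : Rabs (pdot i a y - pdot i a x) < (pdot i a x + b - x i) / 2).
  { apply HP. intros j Hj. eapply Rlt_le_trans; [apply Hy; lia|apply Rmin_l]. }
  assert (H2 : Rabs (y i - x i) < (pdot i a x + b - x i) / 2).
  { eapply Rlt_le_trans; [apply Hy; lia|apply Rmin_r]. }
  apply Rabs_def2 in H1, H2. lra.
Qed.

(** A bound on coordinate [i] involves only earlier coordinates, so moving [x i] alone inside the
    ball makes it strict. Conversely each strict affine inequality persists on a small box, and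
    there are finitely many of them. *)
Lemma interior_prism (d : nat) (s : prism) (x : point) :
  Defs.interior d (in_prism d s) x <-> in_open_prism d s x.
Proof.
  split.
  - intros [e [He H]] i Hi.
    assert (near : forall t, Rabs t < e -> in_prism d s (shift x i t)).
    { intros t Ht. apply H. intros j _. unfold shift.
      destruct (j =? i); [replace (x j + t - x j) with t by ring; exact Ht|].
      rewrite Rminus_diag, Rabs_R0. exact He. }
    split.
    + destruct (near (- (e / 2))) with (i := i) as [L _]; [rewrite Rabs_Ropp, Rabs_pos_eq; lra|exact Hi|].
      destruct (lo s i) as [[a b]|]; [|exact I]. rewrite pdot_shift, Nat.ltb_irrefl in L.
      unfold shift in L. rewrite Nat.eqb_refl in L. lra.
    + destruct (near (e / 2)) with (i := i) as [_ U]; [rewrite Rabs_pos_eq; lra|exact Hi|].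
      destruct (Defs.up s i) as [[a b]|]; [|exact I]. rewrite pdot_shift, Nat.ltb_irrefl in U.
      unfold shift in U. rewrite Nat.eqb_refl in U. lra.
  - intros H.
    destruct (uniform_radius d (fun i r => forall y,
      (forall j, (j < d)%nat -> Rabs (y j - x j) < r) ->
      (match lo s i with Some (a, b) => pdot i a y + b <= y i | None => True end) /\
      (match Defs.up s i with Some (a, b) => y i <= pdot i a y + b | None => True end)))
      as [r [Hr HP]].
    + intros i r r' Hr Hr' y Hy. apply Hr. intros j Hj.
      eapply Rlt_le_trans; [now apply Hy|apply Hr'].
    + intros i Hi. destruct (H i Hi) as [L U].
      assert (EL : exists r, 0 < r /\ forall y,
        (forall j, (j < d)%nat -> Rabs (y j - x j) < r) ->
        match lo s i with Some (a, b) => pdot i a y + b <= y i | None => True end).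
      { destruct (lo s i) as [[a b]|]; [now apply lower_radius|].
        exists 1. split; [lra|]. intros; exact I. }
      assert (EU : exists r, 0 < r /\ forall y,
        (forall j, (j < d)%nat -> Rabs (y j - x j) < r) ->
        match Defs.up s i with Some (a, b) => y i <= pdot i a y + b | None => True end).
      { destruct (Defs.up s i) as [[a b]|]; [now apply upper_radius|].
        exists 1. split; [lra|]. intros; exact I. }
      destruct EL as [r1 [H1 L1]], EU as [r2 [H2 U2]].
      exists (Rmin r1 r2). split; [now apply Rmin_glb_lt|]. intros y Hy. split.
      * apply L1. intros j Hj. eapply Rlt_le_trans; [now apply Hy|apply Rmin_l].
      * apply U2. intros j Hj. eapply Rlt_le_trans; [now apply Hy|apply Rmin_r].
    + exists r. split; [exact Hr|]. intros y Hy i Hi. now apply HP.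
Qed.

Lemma segment_pos (u v t : R) : 0 <= t <= 1 -> 0 < u -> 0 < v -> 0 < u + t * (v - u).
Proof. intros Ht Hu Hv. destruct (Rle_or_lt u v); nra. Qed.

Lemma in_open_prism_segment (d : nat) (s : prism) (x y : point) (t : R) :
  0 <= t <= 1 -> in_open_prism d s x -> in_open_prism d s y ->
  in_open_prism d s (fun j => x j + t * (y j - x j)).
Proof.
  intros Ht Hx Hy i Hi. destruct (Hx i Hi) as [Lx Ux], (Hy i Hi) as [Ly Uy]. split.
  - destruct (lo s i) as [[a b]|]; [|exact I]. rewrite pdot_segment.
    pose proof (segment_pos (x i - pdot i a x - b) (y i - pdot i a y - b) t Ht). lra.
  - destruct (Defs.up s i) as [[a b]|]; [|exact I]. rewrite pdot_segment.
    pose proof (segment_pos (pdot i a x + b - x i) (pdot i a y + b - y i) t Ht). lra.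
Qed.

(** Openness lets one step from a common point to both sides along an axis with [a i <> 0].
    Convexity keeps a segment joining the two sides inside, and it crosses the hyperplane. *)
Lemma open_prism_meets_hyperplane (d : nat) (s : prism) (a : point) (b : R) :
  (exists i, (i < d)%nat /\ a i <> 0) ->
  (exists x, pdot d a x = b /\ in_open_prism d s x) <->
  (exists x, in_open_prism d s x /\ 0 < pdot d a x - b) /\
  (exists x, in_open_prism d s x /\ 0 < b - pdot d a x).
Proof.
  intros [i [Hi Hai]]. split.
  - intros [x [Hx Ix]]. apply interior_prism in Ix. destruct Ix as [e [He H]].
    assert (near : forall t, Rabs t < e -> in_open_prism d s (shift x i t)).
    { intros t Ht. apply interior_prism. exists (e - Rabs t). split; [lra|].
      intros y Hy. apply H. intros j Hj. specialize (Hy j Hj). unfold shift in Hy.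
      destruct (j =? i).
      - replace (y j - x j) with ((y j - (x j + t)) + t) by ring.
        eapply Rle_lt_trans; [apply Rabs_triang|]. lra.
      - pose proof (Rabs_pos t). lra. }
    assert (pos : forall t, pdot d a (shift x i t) - b = a i * t).
    { intros t. rewrite pdot_shift. destruct (Nat.ltb_spec i d); [lra|lia]. }
    destruct (Rlt_or_le 0 (a i)) as [P|N]; split;
      [exists (shift x i (e / 2))|exists (shift x i (- (e / 2)))
      |exists (shift x i (- (e / 2)))|exists (shift x i (e / 2))];
      (split; [apply near; rewrite ?Rabs_Ropp, Rabs_pos_eq; lra|]);
      match goal with |- context [shift x i ?t] => specialize (pos t) end; nra.
  - intros [[x [Ix Hx]] [y [Iy Hy]]].
    (* The affine function [pdot d a - b] vanishes at this parameter of the segment from [x] to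
       [y]. *)
    set (t := (pdot d a x - b) / (pdot d a x - pdot d a y)).
    exists (fun j => x j + t * (y j - x j)). split.
    + rewrite pdot_segment. unfold t. field. lra.
    + apply in_open_prism_segment; [|exact Ix|exact Iy]. unfold t. split.
      * apply Rlt_le, Rdiv_lt_0_compat; lra.
      * apply Rmult_le_reg_r with (pdot d a x - pdot d a y); [lra|].
        unfold Rdiv. rewrite Rmult_assoc, Rinv_l; lra.
Qed.

(** Coefficients of the form $x_i - \sum_{j<i} a_j x_j$, which expresses prism bounds and test
    hyperplanes alike through [pdot d]. *)
Definition conormal (i : nat) (a : point) : point :=
  fun j => if j <? i then - a j else if j =? i then 1 else 0.

Lemma pdot_conormal (d i : nat) (a x : point) :
  (i < d)%nat -> pdot d (conormal i a) x = x i - pdot i a x.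
Proof.
  assert (H : forall k, (k <= i)%nat -> pdot k (conormal i a) x = - pdot k a x).
  { induction k as [|k IH]; intros Hk; simpl; [ring|].
    rewrite IH by lia. unfold conormal. destruct (Nat.ltb_spec k i); [ring|lia]. }
  induction d as [|d IH]; intros Hd; [lia|]. simpl.
  destruct (Nat.eq_dec i d) as [->|].
  - rewrite H by lia. unfold conormal. rewrite Nat.ltb_irrefl, Nat.eqb_refl. ring.
  - rewrite IH by lia. unfold conormal.
    destruct (Nat.ltb_spec d i), (Nat.eqb_spec d i); try lia. ring.
Qed.

(** * The lower bound *)

(* Row by row enumeration of the pairs [(i, j)] with [j <= i]. *)
Fixpoint pair_of (k : nat) : nat * nat :=
  match k with
  | O => (O, O)
  | S k' => let (i, j) := pair_of k' in if j <? i then (i, S j) else (S i, O)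
  end.

(** Inverse of [pair_of] on pairs with [j <= i]: a triangular number counts the earlier rows. *)
Definition index_of (i j : nat) : nat := (i * (i + 1) / 2 + j)%nat.

Lemma pair_of_spec (k i j : nat) :
  pair_of k = (i, j) -> (j <= i)%nat /\ (2 * k = i * (i + 1) + 2 * j)%nat.
Proof.
  revert i j; induction k as [|k IH]; intros i j; simpl.
  - intros [= <- <-]. lia.
  - destruct (pair_of k) as [i' j']. destruct (IH i' j' eq_refl).
    destruct (Nat.ltb_spec j' i'); intros [= <- <-]; nia.
Qed.

Lemma index_of_pair (k i j : nat) : pair_of k = (i, j) -> index_of i j = k.
Proof.
  intros E. destruct (pair_of_spec k i j E). unfold index_of.
  replace (i * (i + 1))%nat with ((k - j) * 2)%nat by nia. rewrite Nat.div_mul; nia.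
Qed.

(** On [x >= 0] this dominates every ceiling slope with coefficient -1 at [j]. For [j = i] the index
    [j] is outside the sum over [l < i], and the constant term carries the choice instead. *)
Definition slope (j : nat) : point := fun l => if l =? j then -1 else 1.

(** Growth by 4 per coordinate keeps a point whose coordinate [i] lies on a test hyperplane below
    the ceilings of all later coordinates, although their slopes may subtract that coordinate. *)
Definition height (i : nat) : R := 4 * INR i + 4.

(** The pair [(d, 0)] has index [d * (d + 1) / 2], the last one, and stands for the extra
    hyperplane. *)
Definition test_hyperplane (d k : nat) (x : point) : Prop :=
  let (i, j) := pair_of k in
  if i =? d then pdot d (conormal (d - 1) (fun _ => 0)) x = -1
  else pdot d (conormal i (slope j)) x = height i - (if j =? i then 1 else 0).

Definition ceiling_slope (T : nat -> bool) (i : nat) : point :=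
  fun l => if T (index_of i l) then 1 else -1.

Definition ceiling_drop (T : nat -> bool) (i : nat) : R :=
  if T (index_of i i) then 0 else 1.

Definition test_prism (d : nat) (T : nat -> bool) : prism :=
  mkPrism
    (fun i => if ((i =? d - 1) && T (index_of d 0))%bool then None else Some (fun _ => 0, 0))
    (fun i => Some (ceiling_slope T i, height i - ceiling_drop T i)).

Lemma pdot_zero (k : nat) (x : point) : pdot k (fun _ => 0) x = 0.
Proof. induction k as [|k IH]; simpl; [reflexivity|]. rewrite IH. ring. Qed.

Lemma pdot_bounds (k : nat) (a x : point) :
  (forall l, (l < k)%nat -> -1 <= a l <= 1) -> (forall l, (l < k)%nat -> 0 <= x l) ->
  - pdot k (fun _ => 1) x <= pdot k a x <= pdot k (fun _ => 1) x.
Proof.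
  intros Ha Hx. split; [|apply pdot_le; intros l Hl; specialize (Ha l Hl); specialize (Hx l Hl); nra].
  replace (- pdot k (fun _ => 1) x) with (pdot k (fun _ => 0 - 1) x).
  - apply pdot_le. intros l Hl. specialize (Ha l Hl); specialize (Hx l Hl); nra.
  - rewrite pdot_sub, pdot_zero. ring.
Qed.

(** Outside coordinate [i] the point is near [e_j] if [j < i] and near the origin if [j = i]; [i] is
    tested first so that [g] wins when [j = i]. *)
Definition witness (i j : nat) (r g : R) : point :=
  fun l => if l =? i then g else if l =? j then 1 else r.

Lemma witness_sum (k i j : nat) (r g : R) : 0 <= r ->
  pdot k (fun _ => 1) (witness i j r g) <=
  INR k * r + (if j <? k then 1 else 0) + (if i <? k then g else 0).
Proof.
  intros Hr. induction k as [|k IH]; [simpl; lra|]. rewrite S_INR. simpl pdot.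
  unfold witness at 2.
  destruct (Nat.eqb_spec k i), (Nat.eqb_spec k j), (Nat.ltb_spec j k), (Nat.ltb_spec i k),
    (Nat.ltb_spec j (S k)), (Nat.ltb_spec i (S k)); try lia; lra.
Qed.

Lemma slope_bounds (j l : nat) : -1 <= slope j l <= 1.
Proof. unfold slope. destruct (l =? j); lra. Qed.

Lemma ceiling_slope_bounds (T : nat -> bool) (i l : nat) : -1 <= ceiling_slope T i l <= 1.
Proof. unfold ceiling_slope. destruct (T (index_of i l)); lra. Qed.

Lemma ceiling_drop_bounds (T : nat -> bool) (i : nat) : 0 <= ceiling_drop T i <= 1.
Proof. unfold ceiling_drop. destruct (T (index_of i i)); lra. Qed.

(** At [j] the slopes differ by 2 and the coordinate is 1; every other term is at least [- 2 * r].
    As [k <= i], coordinate [i] does not enter. *)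
Lemma ceiling_gap (T : nat -> bool) (i j k : nat) (r g : R) :
  0 <= r -> (k <= i)%nat -> ((j < i)%nat -> T (index_of i j) = true) ->
  (if j <? k then 2 else 0) - 2 * (INR k * r) <=
  pdot k (fun l => ceiling_slope T i l - slope j l) (witness i j r g).
Proof.
  intros Hr Hk HT. induction k as [|k IH]; [simpl; lra|]. rewrite S_INR. simpl pdot.
  specialize (IH (Nat.lt_le_incl _ _ Hk)).
  assert (step : (if k =? j then 2 else - 2 * r) <=
    (ceiling_slope T i k - slope j k) * witness i j r g k).
  { unfold witness. destruct (Nat.eqb_spec k i); [lia|].
    destruct (Nat.eqb_spec k j) as [->|].
    - unfold ceiling_slope, slope. rewrite HT, Nat.eqb_refl by lia. lra.
    - pose proof (ceiling_slope_bounds T i k). pose proof (slope_bounds j k). nra. }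
  destruct (Nat.eqb_spec k j), (Nat.ltb_spec j k), (Nat.ltb_spec j (S k)); try lia; lra.
Qed.

(** The radius [1 / (4 d)] makes all small coordinates together add up to at most 1/4. *)
Lemma small_radius (d k : nat) : (1 <= d)%nat -> (k <= d)%nat ->
  INR k * (/ (4 * INR d)) <= / 4.
Proof.
  intros Hd Hk. apply le_INR in Hd, Hk. simpl in Hd.
  apply Rmult_le_reg_r with (4 * INR d); [lra|].
  rewrite Rmult_assoc, Rinv_l by lra. lra.
Qed.

Lemma radius_bounds (d : nat) : (1 <= d)%nat -> 0 < / (4 * INR d) <= / 4.
Proof.
  intros Hd. pose proof (small_radius d 1 Hd Hd). apply le_INR in Hd. simpl in *.
  split; [apply Rinv_0_lt_compat|]; lra.
Qed.

(** Positivity of the earlier coordinates lets slopes be compared termwise: the ceiling lies at or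
    below the hyperplane, and the open prism strictly below the ceiling. *)
Lemma test_prism_misses (d i j : nat) (T : nat -> bool) (x : point) :
  (i < d)%nat -> (j <= i)%nat -> T (index_of i j) = false ->
  in_open_prism d (test_prism d T) x ->
  pdot d (conormal i (slope j)) x <> height i - (if j =? i then 1 else 0).
Proof.
  intros Hi Hj HT Hx. rewrite pdot_conormal by exact Hi.
  (* Only the floor of coordinate [d - 1] can be missing, and [l < i] comes before it. *)
  assert (pos : forall l, (l < i)%nat -> 0 < x l).
  { intros l Hl. destruct (Hx l) as [L _]; [lia|]. simpl in L.
    destruct (Nat.eqb_spec l (d - 1)); [lia|]. simpl in L. rewrite pdot_zero in L. lra. }
  destruct (Hx i Hi) as [_ U]. simpl in U.
  assert (pdot i (ceiling_slope T i) x <= pdot i (slope j) x).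
  { apply pdot_le. intros l Hl. apply Rmult_le_compat_r; [apply Rlt_le; auto|].
    unfold slope. destruct (Nat.eqb_spec l j) as [->|].
    - unfold ceiling_slope. rewrite HT. lra.
    - apply ceiling_slope_bounds. }
  destruct (Nat.eqb_spec j i) as [->|].
  - unfold ceiling_drop in U. rewrite HT in U. lra.
  - pose proof (ceiling_drop_bounds T i). lra.
Qed.

Lemma test_prism_meets (d i j : nat) (T : nat -> bool) :
  (i < d)%nat -> (j <= i)%nat -> T (index_of i j) = true ->
  exists x, pdot d (conormal i (slope j)) x = height i - (if j =? i then 1 else 0) /\
    in_open_prism d (test_prism d T) x.
Proof.
  intros Hi Hj HT. set (r := / (4 * INR d)).
  assert (Hd : (1 <= d)%nat) by lia. destruct (radius_bounds d Hd) as [r_pos r_le]. fold r in r_pos, r_le.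
  assert (kr : forall k, (k <= d)%nat -> INR k * r <= / 4) by (intros; now apply small_radius).
  set (e := if j =? i then 1 else 0).
  assert (He : 0 <= e <= 1) by (unfold e; destruct (j =? i); lra).
  (* Sums over coordinates before [i] ignore [g], so choosing [g] below to put the point on the
     hyperplane is not circular. *)
  assert (same : forall g k a, (k <= i)%nat -> pdot k a (witness i j r g) = pdot k a (witness i j r 0)).
  { intros g k a Hk. apply pdot_ext. intros l Hl. unfold witness.
    destruct (Nat.eqb_spec l i); [lia|reflexivity]. }
  set (g := height i - e + pdot i (slope j) (witness i j r 0)).
  assert (w0 : forall l, 0 <= witness i j r 0 l).
  { intros l. unfold witness. destruct (l =? i), (l =? j); lra. }
  assert (sum0 : forall k, (k <= i)%nat -> pdot k (fun _ => 1) (witness i j r 0) <= 5 / 4).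
  { intros k Hk. pose proof (witness_sum k i j r 0 (Rlt_le _ _ r_pos)).
    pose proof (kr k ltac:(lia)). destruct (j <? k), (i <? k); lra. }
  pose proof (pos_INR i) as Hi0.
  assert (Hg : 4 * INR i + 1 <= g <= 4 * INR i + 21 / 4).
  { pose proof (pdot_bounds i (slope j) (witness i j r 0)
      (fun l _ => slope_bounds j l) (fun l _ => w0 l)).
    pose proof (sum0 i (Nat.le_refl i)). unfold g, height. lra. }
  assert (wg : forall l, 0 < witness i j r g l).
  { intros l. unfold witness. destruct (l =? i), (l =? j); lra. }
  exists (witness i j r g). split.
  - rewrite pdot_conormal, same by lia. unfold witness at 1. rewrite Nat.eqb_refl. unfold g. ring.
  - intros l Hl. split.
    + simpl. destruct ((l =? d - 1) && T (index_of d 0))%bool; [exact I|].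
      rewrite pdot_zero. pose proof (wg l). lra.
    + simpl. pose proof (ceiling_drop_bounds T l).
      pose proof (pdot_bounds l (ceiling_slope T l) (witness i j r g)
        (fun l' _ => ceiling_slope_bounds T l l') (fun l' _ => Rlt_le _ _ (wg l'))) as B.
      pose proof (pos_INR l).
      (* Before [i], coordinates at most 1 lie under ceilings at least 7/4. At [i], [ceiling_gap]
         beats the drop, or for [j = i] the absent drop gains 1 against a slope loss of at most 1/2.
         After [i], the growth of [height] outweighs [g]. *)
      destruct (lt_eq_lt_dec l i) as [[Hli| ->]|Hli].
      * rewrite !(same g) in B by lia. rewrite (same g) by lia. pose proof (sum0 l ltac:(lia)).
        assert (witness i j r g l <= 1).
        { unfold witness. destruct (Nat.eqb_spec l i); [lia|]. destruct (l =? j); lra. }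
        unfold height. lra.
      * unfold witness at 1. rewrite Nat.eqb_refl. unfold g at 1.
        pose proof (ceiling_gap T i j i r g (Rlt_le _ _ r_pos) (Nat.le_refl i) (fun _ => HT)) as G.
        rewrite pdot_sub, !(same g) in G by lia. rewrite (same g) by lia. pose proof (kr i ltac:(lia)).
        unfold e. destruct (Nat.eqb_spec j i) as [->|].
        -- unfold ceiling_drop. rewrite HT. rewrite Nat.ltb_irrefl in G. lra.
        -- destruct (Nat.ltb_spec j i); [lra|lia].
      * pose proof (witness_sum l i j r g (Rlt_le _ _ r_pos)). pose proof (kr l ltac:(lia)).
        assert (witness i j r g l = r).
        { unfold witness. destruct (Nat.eqb_spec l i), (Nat.eqb_spec l j); try lia. reflexivity. }
        assert (INR i + 1 <= INR l) by (rewrite <- S_INR; apply le_INR; lia).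
        destruct (Nat.ltb_spec i l); [|lia]. unfold height.
        destruct (j <? l); lra.
Qed.

Lemma test_prism_floor (d : nat) (T : nat -> bool) : (1 <= d)%nat ->
  (exists x, pdot d (conormal (d - 1) (fun _ => 0)) x = -1 /\
    in_open_prism d (test_prism d T) x) <-> T (index_of d 0) = true.
Proof.
  intros Hd. split.
  - intros [x [Hx Ix]]. rewrite pdot_conormal, pdot_zero in Hx by lia.
    destruct (Ix (d - 1)%nat) as [L _]; [lia|]. simpl in L. rewrite Nat.eqb_refl in L.
    destruct (T (index_of d 0)); [reflexivity|]. simpl in L. rewrite pdot_zero in L. lra.
  - intros HT. set (r := / (4 * INR d)). destruct (radius_bounds d Hd) as [r_pos r_le].
    fold r in r_pos, r_le.
    exists (witness (d - 1) (d - 1) r (-1)). split.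
    + rewrite pdot_conormal, pdot_zero by lia. unfold witness. rewrite Nat.eqb_refl. ring.
    + intros l Hl.
      assert (Hw : forall l', (l' < d - 1)%nat -> witness (d - 1) (d - 1) r (-1) l' = r).
      { intros l' Hl'. unfold witness. destruct (Nat.eqb_spec l' (d - 1)); [lia|reflexivity]. }
      split; simpl.
      * destruct (Nat.eqb_spec l (d - 1)); [rewrite HT; exact I|]. simpl.
        rewrite pdot_zero, Hw by lia. lra.
      * pose proof (ceiling_drop_bounds T l).
        pose proof (pdot_bounds l (ceiling_slope T l) (witness (d - 1) (d - 1) r (-1))
          (fun l' _ => ceiling_slope_bounds T l l')
          (fun l' Hl' => ltac:(rewrite Hw by lia; lra))).
        pose proof (witness_sum l (d - 1) (d - 1) r (-1) (Rlt_le _ _ r_pos)) as W.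
        destruct (Nat.ltb_spec (d - 1) l) in W; [lia|].
        pose proof (small_radius d l Hd ltac:(lia)) as K. fold r in K.
        pose proof (pos_INR l).
        assert (witness (d - 1) (d - 1) r (-1) l <= r).
        { unfold witness. destruct (l =? d - 1); lra. }
        unfold height. lra.
Qed.

(** A prism realising the singleton of [i] meets [H i] but not [H j]. *)
Lemma shattered_distinct (d n : nat) (H : nat -> point -> Prop) :
  (forall T : nat -> bool, exists s : prism, forall i, (i < n)%nat ->
     (meets_interior d (H i) s <-> T i = true)) ->
  forall i j, (i < n)%nat -> (j < n)%nat -> i <> j -> ~ (forall x, H i x <-> H j x).
Proof.
  intros Sh i j Hi Hj Hij E. destruct (Sh (fun k => k =? i)) as [s Hs].
  destruct (proj2 (Hs i Hi) (Nat.eqb_refl i)) as [x [Hx Ix]].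
  assert (C : (j =? i) = true) by (apply (Hs j Hj); exists x; split; [now apply E|exact Ix]).
  apply Nat.eqb_eq in C. congruence.
Qed.

Lemma conormal_hyperplane (d i : nat) (a : point) (b : R) :
  (i < d)%nat -> is_hyperplane d (fun x => pdot d (conormal i a) x = b).
Proof.
  intros Hi. exists (conormal i a), b. split; [|intros x; reflexivity].
  exists i. split; [exact Hi|]. unfold conormal. rewrite Nat.ltb_irrefl, Nat.eqb_refl. lra.
Qed.

Lemma pair_of_range (d k i j : nat) :
  (k < 1 + d * (d + 1) / 2)%nat -> pair_of k = (i, j) ->
  (j <= i)%nat /\ ((i < d)%nat \/ i = d /\ j = O).
Proof.
  intros Hk E. destruct (pair_of_spec k i j E) as [Hj Hkij]. split; [exact Hj|].
  assert (2 * (d * (d + 1) / 2) <= d * (d + 1))%nat by apply Nat.Div0.mul_div_le.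
  destruct (Nat.lt_trichotomy i d) as [|[->|]]; [now left|right; lia|exfalso; nia].
Qed.

Lemma lower_bound (d : nat) : (1 <= d)%nat ->
  shattered d (1 + d * (d + 1) / 2) (test_hyperplane d).
Proof.
  intros Hd.
  assert (Sh : forall T : nat -> bool, exists s : prism,
    forall k, (k < 1 + d * (d + 1) / 2)%nat ->
      (meets_interior d (test_hyperplane d k) s <-> T k = true)).
  { intros T. exists (test_prism d T). intros k Hk.
    unfold meets_interior, test_hyperplane.
    destruct (pair_of k) as [i j] eqn:E. destruct (pair_of_range d k i j Hk E) as [Hj Hi].
    rewrite <- (index_of_pair k i j E).
    destruct (Nat.eqb_spec i d) as [Eid|Nid].
    - destruct Hi as [|[-> ->]]; [lia|]. etransitivity; [|exact (test_prism_floor d T Hd)].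
      split; intros [x [Hx Ix]]; exists x; split; try exact Hx; now apply interior_prism.
    - assert (Hid : (i < d)%nat) by lia. split.
      + intros [x [Hx Ix]]. apply interior_prism in Ix.
        destruct (T (index_of i j)) eqn:HT; [reflexivity|].
        now destruct (test_prism_misses d i j T x Hid Hj HT Ix).
      + intros HT. destruct (test_prism_meets d i j T Hid Hj HT) as [x [Hx Ix]].
        exists x. split; [exact Hx|now apply interior_prism]. }
  split; [|split; [exact (shattered_distinct d _ _ Sh)|exact Sh]].
  intros k Hk. unfold test_hyperplane.
  destruct (pair_of k) as [i j] eqn:E. destruct (pair_of_range d k i j Hk E) as [Hj Hi].
  destruct (Nat.eqb_spec i d); apply conormal_hyperplane; lia.
Qed.

Module Upper.
Import all_boot all_order all_algebra all_classical reals topology normedtype derive.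
Import ring lra zify Rstruct.
Import Order.TTheory GRing.Theory Num.Theory numFieldNormedType.Exports.
Set Implicit Arguments. Unset Strict Implicit. Unset Printing Implicit Defensive.
Local Open Scope ring_scope.

(** * Sign patterns of polynomials *)

Definition monomial (R : realType) (m : nat) (e : 'I_m -> nat) (x : 'rV[R]_m) : R :=
  \prod_i x 0 i ^+ e i.

(** Polynomials are kept as functions, with [D] an upper bound on the total degree, so that degree
    bounds follow from closure rules. *)
Inductive polyf (R : realType) (m D : nat) : ('rV[R]_m -> R) -> Prop :=
| polyf_mon (c : R) (e : 'I_m -> nat) :
    (\sum_i e i <= D)%N -> polyf D (fun x => c * monomial e x)
| polyf_add f g : polyf D f -> polyf D g -> polyf D (fun x => f x + g x).

Lemma eq_polyf (R : realType) (m D : nat) (f g : 'rV[R]_m -> R) :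
  f =1 g -> polyf D f -> polyf D g.
Proof. by move=> /funext ->. Qed.

Lemma polyfW (R : realType) (m D D' : nat) (f : 'rV[R]_m -> R) :
  (D <= D')%N -> polyf D f -> polyf D' f.
Proof.
move=> DD'; elim=> [c e eD|g h _ ? _ ?]; last exact: polyf_add.
by apply: polyf_mon; apply: leq_trans DD'.
Qed.

Lemma polyf_cst (R : realType) (m D : nat) (c : R) : @polyf R m D (fun=> c).
Proof.
apply: (@eq_polyf _ _ _ (fun x => c * monomial (fun=> 0%N) x)).
  by move=> x; rewrite /monomial big1 ?mulr1.
by apply: polyf_mon; rewrite big1.
Qed.

Lemma polyf_coord (R : realType) (m : nat) (i : 'I_m) :
  @polyf R m 1 (fun x => x 0 i).
Proof.
apply: (@eq_polyf _ _ _ (fun x => 1 * monomial (fun j => (j == i) : nat) x)).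
  move=> x; rewrite mul1r /monomial (bigD1 i) //= eqxx expr1 big1 ?mulr1 // => j.
  by move=> /negbTE ->.
by apply: polyf_mon; rewrite (bigD1 i) //= eqxx big1 // => j /negbTE ->.
Qed.

Lemma polyf_mul (R : realType) (m D1 D2 : nat) (f g : 'rV[R]_m -> R) :
  polyf D1 f -> polyf D2 g -> polyf (D1 + D2) (fun x => f x * g x).
Proof.
move=> Pf Pg; elim: Pf => [c e eD|f1 f2 _ IH1 _ IH2]; last first.
  by apply: eq_polyf (polyf_add IH1 IH2) => x; rewrite mulrDl.
elim: Pg => [c' e' eD'|g1 g2 _ IH1 _ IH2]; last first.
  by apply: eq_polyf (polyf_add IH1 IH2) => x; rewrite mulrDr.
apply: (@eq_polyf _ _ _ (fun x => (c * c') * monomial (fun i => e i + e' i)%N x)).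
  move=> x; rewrite mulrACA -big_split /=; congr (_ * _).
  by apply: eq_bigr => i _; rewrite exprD.
by apply: polyf_mon; rewrite big_split leq_add.
Qed.

Lemma polyf_scale (R : realType) (m D : nat) (c : R) (f : 'rV[R]_m -> R) :
  polyf D f -> polyf D (fun x => c * f x).
Proof. by move=> Pf; apply: (@polyf_mul _ _ 0) => //; exact: polyf_cst. Qed.

Lemma polyf_sub (R : realType) (m D : nat) (f g : 'rV[R]_m -> R) :
  polyf D f -> polyf D g -> polyf D (fun x => f x - g x).
Proof.
move=> Pf Pg; apply: polyf_add => //.
by apply: eq_polyf (polyf_scale (-1) Pg) => x; rewrite mulN1r.
Qed.

Lemma polyf_sum (R : realType) (m D : nat) (I : Type) (r : seq I) (P : pred I)
    (F : I -> 'rV[R]_m -> R) :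
  (forall i, P i -> polyf D (F i)) -> polyf D (fun x => \sum_(i <- r | P i) F i x).
Proof.
move=> PF; elim: r => [|i r IH].
  by apply: eq_polyf (polyf_cst m D 0) => x; rewrite big_nil.
have [Pi|/negbTE Pi] := boolP (P i); last first.
  by apply: eq_polyf IH => x; rewrite big_cons Pi.
by apply: eq_polyf (polyf_add (PF i Pi) IH) => x; rewrite big_cons Pi.
Qed.

Lemma polyf_prod (R : realType) (m D : nat) (I : Type) (r : seq I)
    (F : I -> 'rV[R]_m -> R) :
  (forall i, polyf D (F i)) -> polyf (size r * D) (fun x => \prod_(i <- r) F i x).
Proof.
move=> PF; elim: r => [|i r IH].
  by apply: eq_polyf (polyf_cst m _ 1) => x; rewrite big_nil.
by apply: eq_polyf (polyf_mul (PF i) IH) => x; rewrite big_cons.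
Qed.

Lemma polyf_prod_fin (R : realType) (m D : nat) (I : finType)
    (F : I -> 'rV[R]_m -> R) :
  (forall i, polyf D (F i)) -> polyf (#|I| * D) (fun x => \prod_i F i x).
Proof. by move=> PF; rewrite cardT enumT; exact: polyf_prod. Qed.

Lemma polyf_det (R : realType) (m D k : nat) (A : 'rV[R]_m -> 'M[R]_k) :
  (forall i j, polyf D (fun x => A x i j)) -> polyf (k * D) (fun x => \det (A x)).
Proof.
move=> PA; apply: polyf_sum => s _; apply: polyf_scale.
by rewrite -[k in (k * D)%N]card_ord; apply: polyf_prod_fin.
Qed.

(** Lagrange interpolation: a product of affine functions, one for each [b != a], vanishing at [z b]
    and equal to 1 at [z a]. *)
Lemma polyf_dirac (R : realType) (m : nat) (K : finType) (z : K -> 'rV[R]_m) (a : K) :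
  injective z -> exists D f, polyf D f /\ forall b, f (z b) = (b == a)%:R :> R.
Proof.
move=> zI.
have /fin_all_exists [f fP] b : exists f, [/\ polyf 1 f, f (z a) = 1 :> R &
    b != a -> f (z b) = 0].
  have [->|ba] := eqVneq b a; first by exists (fun=> 1); split=> //; exact: polyf_cst.
  have /rowP/eqfunP/forallPn[i zi] : z b <> z a by move/zI/eqP; rewrite (negbTE ba).
  exists (fun x => (z a 0 i - z b 0 i)^-1 * (x 0 i - z b 0 i)); split=> [||_].
  - by apply/polyf_scale/polyf_sub; [exact: polyf_coord|exact: polyf_cst].
  - by rewrite mulVf // subr_eq0 eq_sym.
  - by rewrite subrr mulr0.
exists (#|K| * 1)%N, (fun x => \prod_b f b x); split.
  by apply: polyf_prod_fin => b; case: (fP b).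
move=> b; have [->|ba] := eqVneq b a; first by rewrite big1 // => c _; case: (fP c).
by rewrite (bigD1 b) //= (let: And3 _ _ h := fP b in h ba) mul0r.
Qed.

(** * Counting solutions of the equations $x_i^{e+1} = g_i(x)$ with $\deg g_i \le e$ *)

Lemma monomial_split (R : realType) (m n : nat) (e : 'I_m -> nat) (i : 'I_m)
    (x : 'rV[R]_m) : (n <= e i)%N ->
  monomial e x = x 0 i ^+ n * monomial (fun j => e j - (j == i) * n)%N x.
Proof.
move=> ne; rewrite /monomial (bigD1 i) //= [in RHS](bigD1 i) //= eqxx mul1n mulrA.
rewrite -exprD subnKC //; congr (_ * _); apply: eq_bigr => j /negbTE ->.
by rewrite mul0n subn0.
Qed.

(* Replacing [x_i ^ e.+1] by [g i] lowers the degree. *)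
Lemma polyf_reduce (R : realType) (m e : nat) (K : Type) (z : K -> 'rV[R]_m)
    (g : 'I_m -> 'rV[R]_m -> R) :
  (forall i, polyf e (g i)) -> (forall i k, z k 0 i ^+ e.+1 = g i (z k)) ->
  forall D f, polyf D f -> exists c : {ffun 'I_m -> 'I_e.+1} -> R,
    forall k, f (z k) = \sum_u c u * monomial (fun i => u i) (z k).
Proof.
move=> Pg zg; elim/ltn_ind => D IH f; elim=> {f} [c u uD|f h _ [cf fP] _ [ch hP]]; last first.
  by exists (fun u => cf u + ch u) => k;
    rewrite fP hP -big_split; apply: eq_bigr => u _; rewrite mulrDl.
have [/forallP ltu|/forallPn[i]] := boolP [forall i, u i < e.+1]%N.
  pose v := [ffun i => Ordinal (ltu i)].
  exists (fun w => (w == v)%:R * c) => k.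
  rewrite (bigD1 v) //= eqxx mul1r big1 ?addr0 => [|w /negbTE ->]; last by rewrite !mul0r.
  by congr (_ * _); apply: eq_bigr => i _; rewrite ffunE.
rewrite -leqNgt => leu.
have D_gt : (e.+1 <= D)%N by apply: leq_trans uD; rewrite (bigD1 i) //= (leq_trans leu) ?leq_addr.
pose w j := (u j - (j == i) * e.+1)%N.
have wD : (\sum_j w j <= D - e.+1)%N.
  rewrite leq_subRL //; apply: leq_trans uD; rewrite (bigD1 i) //= [leqRHS](bigD1 i) //=.
  rewrite /w eqxx mul1n addnA subnKC // leq_add2l leq_sum // => j /negbTE ->.
  by rewrite mul0n subn0.
(* Trading [e.+1] factors for a polynomial of degree at most [e] lowers the degree bound, so the
   induction on [D] applies. *)
have ltD : (D - e.+1 + e < D)%N by rewrite -addnS subnK.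
have [d dP] := IH _ ltD _ (polyf_mul (polyf_mon c wD) (Pg i)).
by exists d => k; rewrite -dP (monomial_split _ leu) zg; ring.
Qed.

(** Every Dirac function on the points is a combination of the [e.+1 ^ m] monomials with exponents
    at most [e]. The identity matrix of size [#|K|] thus factors through that dimension, and ranks
    compare. *)
Lemma zeros_bound (R : realType) (m e : nat) (K : finType) (z : K -> 'rV[R]_m)
    (g : 'I_m -> 'rV[R]_m -> R) :
  (forall i, polyf e (g i)) -> (forall i k, z k 0 i ^+ e.+1 = g i (z k)) ->
  injective z -> (#|K| <= e.+1 ^ m)%N.
Proof.
move=> Pg zg zI.
have /fin_all_exists [c cP] a : exists c : {ffun 'I_m -> 'I_e.+1} -> R,
    forall b, (b == a)%:R = \sum_u c u * monomial (fun i => u i) (z b).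
  have [D [f [Pf fP]]] := polyf_dirac a zI.
  by have [c cP] := polyf_reduce Pg zg Pf; exists c => b; rewrite -cP fP.
pose T := {ffun 'I_m -> 'I_e.+1}.
pose A := \matrix_(i < #|K|, j < #|T|) c (enum_val i) (enum_val j).
pose B := \matrix_(j < #|T|, i < #|K|)
  monomial (fun l => (enum_val j : T) l) (z (enum_val i)).
have AB : A *m B = 1%:M.
  apply/matrixP => j i; rewrite !mxE -(inj_eq enum_val_inj) eq_sym cP.
  rewrite [RHS](reindex (fun l : 'I_#|T| => enum_val l : T)) /=.
    by apply: eq_bigr => l _; rewrite !mxE.
  exact/onW_bij/enum_val_bij.
have := mulmx_max_rank A B; rewrite AB mxrank1 => /leq_trans; apply.
by rewrite card_ffun !card_ord.
Qed.

(** The partial derivative is read off the univariate polynomial that restricts [f] to an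
    axis-parallel line, which reduces critical points to one-variable calculus. *)
Lemma polyf_partial (R : realType) (m D : nat) (f : 'rV[R]_m -> R) (i : 'I_m) :
  polyf D f -> exists2 f', polyf D.-1 f' & forall x, exists2 p : {poly R},
    forall t, f (x + t *: delta_mx 0 i) = p.[t] & p^`().[0] = f' x.
Proof.
elim=> [c e eD|g h _ [g' Pg' gP] _ [h' Ph' hP]]; last first.
  exists (fun x => g' x + h' x); first exact: polyf_add.
  move=> x; have [[p pP p'] [q qP q']] := (gP x, hP x).
  by exists (p + q) => [t|]; rewrite ?derivD hornerD ?pP ?qP // p' q'.
exists (fun x => (c * (e i)%:R) * monomial (fun j => e j - (j == i))%N x).
  have [ei0|ei_gt0] := posnP (e i).
    by apply: eq_polyf (polyf_cst _ _ 0) => x; rewrite ei0 mulr0 mul0r.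
  have D_gt0 : (0 < D)%N by apply: leq_trans eD; rewrite (bigD1 i) //= addn_gt0 ei_gt0.
  apply: polyf_mon; rewrite -ltnS prednK //.
  apply: leq_trans eD; rewrite (bigD1 i) //= [leqRHS](bigD1 i) //= eqxx subn1.
  by rewrite -addSn prednK // leq_add2l leq_sum // => j _; rewrite leq_subr.
move=> x; exists ((c * \prod_(j | j != i) x 0 j ^+ e j) *: ('X + (x 0 i)%:P) ^+ e i) => [t|].
  rewrite hornerZ horner_exp !hornerE /monomial (bigD1 i) //= !mxE !eqxx mulr1.
  rewrite (eq_bigr (fun j => x 0 j ^+ e j)) => [|j /negbTE ji].
    by rewrite [x 0 i + t]addrC mulrA mulrAC.
  by rewrite !mxE ji andbF mulr0 addr0.
rewrite derivZ hornerZ deriv_exp hornerMn hornerM horner_exp derivD derivX derivC !hornerE.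
rewrite /monomial [in RHS](bigD1 i) //= eqxx subn1 -mulr_natr.
have -> : \prod_(j | j != i) x 0 j ^+ (e j - (j == i)) = \prod_(j | j != i) x 0 j ^+ e j.
  by apply: eq_bigr => j /negbTE ->; rewrite subn0.
ring.
Qed.

(** * Continuity, local maxima and the bound on sign patterns *)

Lemma polyf_continuous (R : realType) (m D : nat) (f : 'rV[R]_m -> R) :
  polyf D f -> continuous f.
Proof.
elim=> [c e _|g h _ cg _ ch] x; last exact: cvgD (cg x) (ch x).
have prodc r : continuous (fun y : 'rV[R]_m => \prod_(i <- r) y 0 i ^+ e i).
  elim: r => [|i r IH] y.
    rewrite (_ : (fun _ => _) = fun=> 1); first exact: cst_continuous.
    by apply/funext => u; rewrite big_nil.
  rewrite (_ : (fun _ => _) = fun u : 'rV[R]_m => u 0 i ^+ e i * \prod_(j <- r) u 0 j ^+ e j); last first.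
    by apply/funext => u; rewrite big_cons.
  apply: (continuousM (s := fun u : 'rV[R]_m => u 0 i ^+ e i) _ (IH y)).
  apply: (@continuous_comp _ _ _ (fun u : 'rV[R]_m => u 0 i) (fun t => t ^+ e i)).
    exact: coord_continuous.
  by rewrite (_ : (fun t => _) = horner 'X^(e i));
    [exact: continuous_horner|apply/funext => t; rewrite hornerXn].
apply: (continuousM (s := fun=> c) (t := monomial e)); first exact: cst_continuous.
exact: prodc.
Qed.

Lemma horner_max (R : realType) (p : {poly R}) :
  (\forall t \near 0, p.[t] <= p.[0]) -> p^`().[0] = 0.
Proof.
case/nbhs_ballP => e /= e0 pe.
have itv t : t \in `]-e, e[ -> p.[t] <= p.[0].
  by rewrite in_itv => /= te; apply: pe; rewrite /ball /= sub0r normrN ltr_norml.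
have e0' : - e < e by rewrite gtrN.
have itv0 : (0 : R) \in `]-e, e[ by rewrite in_itv /= oppr_lt0 e0.
have := derive1_at_max (ltW e0') (fun t _ => @derivable_horner R p t) itv0 itv.
by case=> _ h; rewrite derivE derive1E.
Qed.

Lemma finite_pos_lower_bound (R : realType) (I : finType) (v : I -> R) :
  (forall i, 0 < v i) -> exists2 d, 0 < d & forall i, d <= v i.
Proof.
(* This value is at most every [v i] and stays positive for an empty family. *)
move=> v0; exists (1 + \sum_i (v i)^-1)^-1 => [|i].
  by rewrite invr_gt0 ltr_wpDr // sumr_ge0 // => i _; rewrite invr_ge0 ltW.
rewrite invf_ple ?posrE ?v0 //; last first.
  by rewrite ltr_wpDr // sumr_ge0 // => j _; rewrite invr_ge0 ltW.
rewrite (bigD1 i) //= addrCA lerDl addr_ge0 // sumr_ge0 // => j _.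
by rewrite invr_ge0 ltW.
Qed.

Lemma polyf_near_gt0 (R : realType) (m D : nat) (I : finType) (f : I -> 'rV[R]_m -> R)
    (z : 'rV[R]_m) (i : 'I_m) :
  (forall l, polyf D (f l)) -> (forall l, 0 < f l z) ->
  \forall t \near (0 : R), forall l, 0 < f l (z + t *: delta_mx 0 i).
Proof.
move=> Pf fz.
refine (@filter_forall _ I (fun l t => 0 < f l (z + t *: delta_mx 0 i)) (nbhs (0 : R)) _ _) => l.
have [f' _ /(_ z)[p fp _]] := polyf_partial i (Pf l).
have p0 : 0 < p.[0] by rewrite -fp scale0r addr0.
have /cvgr_gt /(_ _ p0) := @continuous_horner R p 0.
by apply: filterS => t; rewrite fp.
Qed.

(* Each cell of the arrangement contains a critical point of
   [F ^ 2 - eps * \sum_i x_i ^ (n + 2)], where [n] is the degree of [F ^ 2] and [F] is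
   the product of the polynomials and of the equations of the walls of a large box. The
   critical points solve [x_i ^ (n + 1) = g_i x] with [deg g_i <= n]. *)
Lemma strict_sign_bound (R : realType) (m D : nat) (L K : finType)
    (g : L -> 'rV[R]_m -> R) (p : K -> 'rV[R]_m) :
  (forall l, polyf D (g l)) -> (forall l a, g l (p a) != 0) ->
  (forall a b, a != b -> exists l, g l (p a) * g l (p b) < 0) ->
  (#|K| <= (2 * (#|L| * D + m * 2)).+1 ^ m)%N.
Proof.
move=> Pg gp0 sep; set n := (2 * _)%N.
(* All the points lie strictly inside this box, so the wall factors of [F] do not vanish at them. *)
have [B Bp] : exists B : R, forall a i, `|p a 0 i| < B.
  exists (1 + \sum_a \sum_i `|p a 0 i|) => a i.
  rewrite ltr_pwDl // (bigD1 a) //= (bigD1 i) //= -!addrA lerDl.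
  by rewrite addr_ge0 ?sumr_ge0 // => b _; rewrite sumr_ge0.
pose F x := \prod_l g l x * \prod_(i < m) (B ^+ 2 - x 0 i ^+ 2).
(* As [n] is even, [S] is nonnegative; its partial derivatives are multiples of $x_i^{n+1}$, above
   the degree of those of [F ^ 2]. *)
pose S (x : 'rV[R]_m) := \sum_i x 0 i ^+ n.+2.
have Pbox i : polyf 2 (fun x : 'rV[R]_m => B ^+ 2 - x 0 i ^+ 2).
  by apply: polyf_sub; [exact: polyf_cst|apply: (@polyf_mul _ _ 1 1); exact: polyf_coord].
have PF2 : polyf n (fun x => F x ^+ 2).
  have PF : polyf (#|L| * D + m * 2) F.
    apply: polyf_mul; first exact: polyf_prod_fin.
    rewrite -[m in (m * 2)%N]card_ord; exact: polyf_prod_fin.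
  by rewrite /n mul2n -addnn; exact: polyf_mul.
have S_ge0 x : 0 <= S x.
  by apply: sumr_ge0 => i _; rewrite exprn_even_ge0 //= negbK /n mul2n odd_double.
have Fp a : 0 < F (p a) ^+ 2.
  rewrite exprn_even_gt0 //= mulf_neq0 //; apply/prodf_neq0 => i _ //.
  rewrite gt_eqF // subr_gt0 -[ltLHS]real_normK ?num_real //.
  by rewrite ltr_pXn2r ?nnegrE // (le_trans _ (ltW (Bp a i))).
have [eps eps_gt0 epsP] : exists2 eps, 0 < eps & forall a, eps * S (p a) < F (p a) ^+ 2.
  have [|eps e0 le_eps] := @finite_pos_lower_bound R K (fun a => F (p a) ^+ 2 / (S (p a) + 1)).
    by move=> a; rewrite divr_gt0 // ltr_wpDl.
  exists eps => // a; move: (le_eps a); rewrite ler_pdivlMr ?ltr_wpDl // mulrDr mulr1.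
  by apply: lt_le_trans; rewrite ltrDl.
pose G x := F x ^+ 2 - eps * S x.
(* The closed cell of [p a] inside the box, compact because the inequalities are weak. *)
pose A a := ([set x : 'rV[R]_m | forall i, x 0 i \in `[-B, B]%R] `&`
             [set x | forall l, 0 <= g l (p a) * g l x])%classic.
have cA a : compact (A a).
  apply: compact_closedI.
    by apply: (@rV_compact _ _ (fun=> [set` `[-B, B]%R]%classic)) => _; exact: segment_compact.
  rewrite (_ : [set x | _]%classic =
      (\bigcap_(l in setT) ((fun x => g l (p a) * g l x) @^-1` [set t | 0 <= t]))%classic).
    apply: closed_bigI => l _.
    have cg : continuous (fun x => g l (p a) * g l x).
      exact: polyf_continuous (polyf_scale (g l (p a)) (Pg l)).
    by move/continuous_closedP: cg => /(_ _ (@closed_ge R 0)).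
  by apply/seteqP; split=> x h l; [move=> _; exact: h|exact: (h l Logic.I)].
have PG : polyf n.+2 G.
  apply: polyf_sub; first exact: polyfW (leqW (leqnSn n)) PF2.
  apply/polyf_scale/polyf_sum => i _.
  apply: (@eq_polyf _ _ _ (fun x => 1 * monomial (fun j => (j == i) * n.+2)%N x)).
    move=> x; rewrite mul1r /monomial (bigD1 i) //= eqxx mul1n big1 ?mulr1 // => j.
    by move=> /negbTE ->.
  by apply: polyf_mon; rewrite (bigD1 i) //= eqxx mul1n big1 ?addn0 // => j /negbTE ->.
have Ap a : A a (p a).
  split=> [i|l] /=; last by rewrite -expr2 sqr_ge0.
  by rewrite in_itv /= -ler_norml ltW.
have /fin_all_exists [z zP] a : exists z, [/\ A a z, 0 < G z & forall x, A a x -> G x <= G z].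
  have [||z] := @EVT_max_rV R m G (A a) _ (cA a).
  - by exists (p a).
  - exact/continuous_subspaceT/(polyf_continuous PG).
  rewrite inE => Az maxz; exists z; split=> // [|x Ax]; last by apply: maxz; rewrite inE.
  by apply: lt_le_trans (maxz _ _); rewrite ?inE // subr_gt0.
(* [F] vanishes on the boundary of a cell, so [G <= 0] there, and a maximiser with [G > 0] is
   interior. *)
have Fz a : F (z a) != 0.
  have [_ Gz _] := zP a; apply: contraTneq Gz => F0.
  by rewrite -leNgt /G F0 expr0n /= sub0r oppr_le0 mulr_ge0 // ltW.
have gz a l : 0 < g l (p a) * g l (z a).
  have [[_ Al] _ _] := zP a; have := Al l; rewrite le0r mulf_eq0 (negbTE (gp0 _ _)) /=.
  case/orP=> // /eqP gl0; move: (Fz a); rewrite /F (bigD1 l) //= gl0.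
  by rewrite !mul0r eqxx.
have zB a i : 0 < B ^+ 2 - z a 0 i ^+ 2.
  have [[Ai _] _ _] := zP a; have := Ai i; rewrite /= in_itv /= -ler_norml => le_zB.
  have : 0 <= B ^+ 2 - z a 0 i ^+ 2.
    by rewrite subr_ge0 -[z a 0 i ^+ 2]real_normK ?num_real // ler_sqr ?nnegrE // (le_trans _ le_zB).
  rewrite le0r; case/orP=> // /eqP h; move: (Fz a); rewrite /F [X in _ * X](bigD1 i) //= h.
  by rewrite mul0r mulr0 eqxx.
have nearA a i : \forall t \near (0 : R), A a (z a + t *: delta_mx 0 i).
  have near1 := polyf_near_gt0 i (fun l => polyf_scale (g l (p a)) (Pg l)) (gz a).
  have near2 := polyf_near_gt0 i Pbox (zB a).
  apply: filterS2 near1 near2 => t h1 h2; split=> [j|l]; last exact/ltW/h1.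
  have B_ge0 : 0 <= B by rewrite (le_trans _ (ltW (Bp a i))).
  rewrite /= in_itv /= -ler_norml -ler_sqr ?nnegrE // real_normK ?num_real //.
  by rewrite -subr_ge0 ltW.
have /fin_all_exists2[h Ph hP] i := polyf_partial i PF2.
have crit a i : h i (z a) = eps * (n.+2)%:R * z a 0 i ^+ n.+1.
  have [q qP <-] := hP i (z a).
  pose P := q - eps *: (('X + (z a 0 i)%:P) ^+ n.+2 + (\sum_(j | j != i) z a 0 j ^+ n.+2)%:P).
  have GP t : G (z a + t *: delta_mx 0 i) = P.[t].
    rewrite /G qP /S (bigD1 i) //= !mxE !eqxx mulr1 /P !hornerE.
    rewrite [z a 0 i + t]addrC; congr (_ - _ * (_ + _)); apply: eq_bigr => j /negbTE ji.
    by rewrite !mxE ji andbF mulr0 addr0.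
  have : P^`().[0] = 0.
    apply: horner_max; apply: filterS (nearA a i) => t At.
    by rewrite -!GP scale0r addr0; case: (zP a) => _ _; apply.
  rewrite /P derivB derivZ derivD deriv_exp derivD derivX !derivC !addr0 mul1r.
  rewrite hornerD hornerN hornerZ hornerMn horner_exp !hornerE.
  by move/subr0_eq ->; rewrite -mulr_natr; ring.
apply: (@zeros_bound R m n K z (fun i x => (eps * (n.+2)%:R)^-1 * h i x)).
- by move=> i; apply: polyf_scale; apply: polyfW (Ph i); exact: leq_pred.
- by move=> i a; rewrite crit mulKf // mulf_neq0 ?pnatr_eq0 // gt_eqF.
(* If [z a = z b], every [g l] has the same strict sign at [p a] and [p b], against separation. *)
move=> a b zab; apply/eqP; apply: contraT => /sep[l].
rewrite ltNge => /negP[]; have := gz b l; rewrite -zab => gb.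
have := mulr_gt0 (gz a l) gb; rewrite mulrACA -expr2.
move/ltW; rewrite pmulr_lge0 // exprn_even_gt0 //=.
by apply: contraTneq (gz a l) => ->; rewrite mulr0 ltxx.
Qed.

(** Shift every [f j] by [d] and by [- d], with [d] below all nonzero absolute values. No shifted
    value is zero, and any difference among the signs -1, 0, 1 becomes strict opposition for one of
    the shifts. *)
Lemma sign_bound (R : realType) (m D : nat) (J K : finType)
    (f : J -> 'rV[R]_m -> R) (p : K -> 'rV[R]_m) :
  (forall j, polyf D (f j)) ->
  (forall a b, a != b -> exists j, Num.sg (f j (p a)) != Num.sg (f j (p b))) ->
  (#|K| <= (2 * (#|J| * 2 * D + m * 2)).+1 ^ m)%N.
Proof.
move=> Pf sep.
have [d d_gt0 dP] : exists2 d, 0 < d & forall ja : J * K,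
    f ja.1 (p ja.2) != 0 -> d < `|f ja.1 (p ja.2)|.
  (* Vanishing values get the default 1; halving the bound then makes the inequality strict. *)
  have [|d d_gt0 dP] := @finite_pos_lower_bound R (J * K)%type
      (fun ja => if f ja.1 (p ja.2) == 0 then 1 else `|f ja.1 (p ja.2)|).
    by move=> ja; case: ifPn => // h; rewrite normr_gt0.
  exists (d / 2) => [|ja]; first by rewrite divr_gt0.
  by move/negbTE => h; have := dP ja; rewrite h; lra.
pose g (l : J * bool) x := f l.1 x + (if l.2 then d else - d).
have -> : (#|J| * 2 = #|{: J * bool}|)%N by rewrite card_prod card_bool.
apply: (@strict_sign_bound _ _ _ _ _ g p).
- by move=> l; apply: polyf_add => //; exact: polyf_cst.
- move=> [j s] a; rewrite /g /=; apply/eqP => /eqP; rewrite addr_eq0 => /eqP E.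
  have := dP (j, a); rewrite /= {}E.
  by case: s; rewrite ?opprK ?normrN gtr0_norm // ltxx ?oppr_eq0 gt_eqF // => /(_ isT).
move=> a b /sep[j]; wlog ltab : a b / f j (p a) < f j (p b) => [wl sg_ab|].
  case: (ltgtP (f j (p a)) (f j (p b))) => [lt|lt|eq]; first exact: wl lt sg_ab.
    by rewrite eq_sym in sg_ab; have [l] := wl b a lt sg_ab; exists l; rewrite mulrC.
  by rewrite eq eqxx in sg_ab.
move=> sg_ab; have := dP (j, a); have := dP (j, b); rewrite /=.
have [b0|b0|b0] := ltgtP (f j (p b)) 0.
- by move: sg_ab; rewrite !ltr0_sg ?eqxx // (lt_trans ltab).
- move=> /(_ isT); rewrite gtr0_norm // => db da.
  exists (j, false); rewrite /g /= nmulr_rlt0 ?subr_gt0 //.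
  have [a0|a0|->] := ltgtP (f j (p a)) 0; [lra| |lra].
  by move: sg_ab; rewrite !gtr0_sg ?eqxx.
- rewrite b0 in ltab; move=> _ /(_ (ltr0_neq0 ltab)); rewrite ltr0_norm // => da.
  by exists (j, true); rewrite /g /= b0 add0r pmulr_llt0 //; lra.
Qed.

(** * Feasibility of strict linear systems *)

Definition feasible (R : realType) (k n : nat) (V : 'M[R]_(k, n)) :=
  exists y : 'cV_n, forall i, 0 < (V *m y) i 0.

Definition certificate (R : realType) (k n : nat) (V : 'M[R]_(k, n)) (l : 'rV[R]_k) :=
  [/\ l != 0, forall i, 0 <= l 0 i & l *m V = 0].

Definition dot (R : realType) (n : nat) (u v : 'rV[R]_n) : R := (u *m v^T) 0 0.

Lemma dot_ge0 (R : realType) (n : nat) (u : 'rV[R]_n) : 0 <= dot u u.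
Proof. by rewrite /dot mxE sumr_ge0 // => i _; rewrite !mxE -expr2 sqr_ge0. Qed.

Lemma dot_eq0 (R : realType) (n : nat) (u : 'rV[R]_n) : (dot u u == 0) = (u == 0).
Proof.
rewrite /dot mxE psumr_eq0 => [|i _]; last by rewrite !mxE -expr2 sqr_ge0.
apply/allP/eqP => [u0|-> i _]; last by rewrite /= !mxE mul0r.
apply/rowP => i; have /implyP := u0 i (mem_index_enum i).
by rewrite !mxE mulf_eq0 orbb => /(_ isT)/eqP.
Qed.

Lemma dot_pencil (R : realType) (n : nat) (u w : 'rV[R]_n) (t : R) :
  dot (u + t *: w) (u + t *: w) = dot u u + t * (dot u w *+ 2 + t * dot w w).
Proof.
have -> : dot u w *+ 2 = dot u w + dot w u.
  rewrite mulr2n; congr (_ + _); rewrite /dot !mxE.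
  by apply: eq_bigr => i _; rewrite !mxE mulrC.
rewrite /dot [(u + _)^T]linearD /= linearZ /= mulmxDl !mulmxDr -!scalemxAl -!scalemxAr.
by rewrite !mxE; ring.
Qed.

(** Pairing [l] with [V *m y] gives a zero sum of nonnegative terms that are positive wherever [l]
    is. *)
Lemma certificate_infeasible (R : realType) (k n : nat) (V : 'M[R]_(k, n)) (l : 'rV[R]_k) :
  certificate V l -> ~ feasible V.
Proof.
move=> [l0 l_ge0 lV] [y Vy]; case/eqP: l0; apply/rowP => i; rewrite [RHS]mxE.
have : (l *m (V *m y)) 0 0 = 0 by rewrite mulmxA lV mul0mx mxE.
rewrite mxE => /eqP; rewrite psumr_eq0 => [|j _]; last by rewrite mulr_ge0 // ltW.
move=> /allP/(_ i (mem_index_enum i)); rewrite mulf_eq0 (gt_eqF (Vy i)) orbF.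
by move/eqP.
Qed.

(* Gordan's theorem: the point [y] of least norm in the convex hull of the rows [v_i]
   satisfies [y . v_i >= y . y]. *)
Lemma gordan (R : realType) (k n : nat) (V : 'M[R]_(k, n)) :
  feasible V <-> ~ exists l, certificate V l.
Proof.
split=> [fV [l /certificate_infeasible]|noc] //.
(* Without rows the simplex below would be empty, but any vector is a solution. *)
case: k V noc => [|k] V noc; first by exists 0 => -[].
pose Delta := ([set l : 'rV[R]_k.+1 | forall i, l 0 i \in `[0, 1]%R] `&`
               (fun l : 'rV[R]_k.+1 => \sum_i l 0 i) @^-1` [set 1])%classic.
have cD : compact Delta.
  apply: compact_closedI.
    by apply: (@rV_compact R _ (fun=> [set` `[0 : R, 1]%R]%classic)) => _; exact: segment_compact.
  have : continuous (fun l : 'rV[R]_k.+1 => \sum_i l 0 i).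
    by apply/(@polyf_continuous _ _ 1)/polyf_sum => i _; exact: polyf_coord.
  by move/continuous_closedP => /(_ _ (@closed_eq R 1)).
have cf : continuous (fun l : 'rV[R]_k.+1 => dot (l *m V) (l *m V)).
  apply: (@polyf_continuous _ _ 2).
  have Pc j : polyf 1 (fun l : 'rV[R]_k.+1 => (l *m V) 0 j).
    apply: (@eq_polyf _ _ _ (fun l => \sum_i V i j * l 0 i)).
      by move=> l; rewrite mxE; apply: eq_bigr => i _; rewrite mulrC.
    by apply: polyf_sum => i _; apply: polyf_scale; exact: polyf_coord.
  apply: (@eq_polyf _ _ _ (fun l => \sum_j (l *m V) 0 j * (l *m V) 0 j)).
    by move=> l; rewrite /dot [RHS]mxE; apply: eq_bigr => j _; rewrite [_^T _ _]mxE.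
  by apply: polyf_sum => j _; exact: polyf_mul (Pc j) (Pc j).
have D0 : (Delta !=set0)%classic.
  exists (delta_mx 0 0); split=> [i|] /=.
    by rewrite mxE eqxx in_itv /=; case: (_ == _); rewrite ?lexx ler01.
  by rewrite (bigD1 0) //= big1 => [|i /negbTE i0]; rewrite mxE ?eqxx ?i0 ?addr0 ?andbF.
have [l] := EVT_min_rV D0 cD (continuous_subspaceT cf).
rewrite inE => -[l01 /= suml] minl; set y := l *m V in minl *.
have l0 : l != 0.
  apply/eqP => l0; move: suml; rewrite l0 big1 => [/eqP|i _]; last by rewrite mxE.
  by rewrite eq_sym oner_eq0.
have y0 : 0 < dot y y.
  rewrite lt0r dot_ge0 dot_eq0 andbT; apply/eqP => y0; apply: noc; exists l; split=> // i.
  by have := l01 i; rewrite in_itv => /andP[].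
exists y^T => i; have -> : (V *m y^T) i 0 = dot y (row i V).
  by rewrite /dot !mxE; apply: eq_bigr => j _; rewrite !mxE mulrC.
pose w := row i V - y.
suff : 0 <= dot y w.
  have -> : dot y w = dot y (row i V) - dot y y.
    by rewrite /dot /w [(_ - _)^T]linearB /= mulmxBr !mxE.
  by rewrite subr_ge0; exact: lt_le_trans.
(* If $y \cdot w < 0$, this [t] lies in $(0, 1]$ and turns $2 y \cdot w + t w \cdot w$ into $(1 + t)
   y \cdot w < 0$, so $y + t w$ is shorter than $y$. *)
rewrite leNgt; apply/negP => yw; pose t := - dot y w / (dot w w - dot y w).
have ww := dot_ge0 w; have den : 0 < dot w w - dot y w by lra.
have t_gt0 : 0 < t by rewrite divr_gt0 ?oppr_gt0.
have t_le1 : t <= 1 by rewrite ler_pdivrMr // mul1r; lra.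
have tE : t * dot w w = - dot y w + t * dot y w.
  rewrite /t; field; exact: lt0r_neq0.
have Dt : l + t *: (delta_mx 0 i - l) \in Delta.
  rewrite inE; split=> [j|] /=.
    have := l01 j; rewrite !in_itv /= !mxE eqxx /= => /andP[lj0 lj1].
    by case: (j == i); rewrite ?mulr1n ?mulr0n; nra.
  under eq_bigr do rewrite !mxE eqxx /=.
  rewrite big_split /= -mulr_sumr sumrB suml (bigD1 i) //= eqxx big1 => [|j /negbTE ->] //.
  by rewrite addr0 subrr mulr0 addr0.
have := minl _ Dt.
have -> : (l + t *: (delta_mx 0 i - l)) *m V = y + t *: w.
  by rewrite mulmxDl -scalemxAl mulmxBl -rowE.
rewrite dot_pencil lerDl pmulr_rge0 // tE leNgt => /negP; apply.
have : t * dot y w < 0 by rewrite pmulr_rlt0.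
by rewrite mulr2n; lra.
Qed.

(** * Principal Gram matrices and certificates of minimal support *)

Definition gram (R : realType) (k n : nat) (I : {set 'I_k}) (V : 'M[R]_(k, n)) : 'M[R]_k :=
  \matrix_(i, j) if (i \in I) && (j \in I) then (V *m V^T) i j else (i == j)%:R.

(** The identity block padding the Gram matrix to size [k] forces [x] to vanish outside [I]. Inside,
    $x V V^T x^T = 0$ is the squared norm of $x V$. *)
Lemma gram_kernel (R : realType) (k n : nat) (I : {set 'I_k}) (V : 'M[R]_(k, n))
    (x : 'rV[R]_k) :
  x *m gram I V = 0 <-> (forall j, j \notin I -> x 0 j = 0) /\ x *m V = 0.
Proof.
have out j : j \notin I -> (x *m gram I V) 0 j = x 0 j.
  move=> /negbTE jI; rewrite mxE (bigD1 j) //= mxE jI eqxx mulr1 big1 ?addr0 // => i.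
  by move=> /negbTE ij; rewrite mxE jI andbF ij mulr0.
have in_ j : (forall j, j \notin I -> x 0 j = 0) -> j \in I ->
    (x *m gram I V) 0 j = (x *m (V *m V^T)) 0 j.
  move=> x0 jI; rewrite !mxE; apply: eq_bigr => i _; rewrite mxE jI andbT.
  by case: ifPn => // /x0 ->; rewrite !mul0r.
split=> [xG|[x0 xV]]; last first.
  apply/rowP => j; rewrite [RHS]mxE; have [jI|jI] := boolP (j \in I).
    by rewrite in_ // mulmxA xV mul0mx mxE.
  by rewrite out // x0.
have x0 j : j \notin I -> x 0 j = 0 by move/out <-; rewrite xG mxE.
split=> //; apply/eqP; rewrite -dot_eq0 /dot trmx_mul mulmxA -[x *m V *m _]mulmxA.
rewrite mxE big1 // => j _; rewrite [x^T _ _]mxE.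
have [jI|/x0 ->] := boolP (j \in I); last by rewrite mulr0.
by rewrite -in_ // xG mxE mul0r.
Qed.

Definition supp (R : realType) (k : nat) (l : 'rV[R]_k) := [set i | l 0 i != 0]%SET.

(** If a relation [x] supported in [supp l] is not a multiple of [l], subtracting [t *: x] with [t]
    the least ratio [l 0 i / x 0 i] over [x 0 i > 0] keeps a certificate and shrinks its support. *)
Lemma minimal_certificate (R : realType) (k n : nat) (V : 'M[R]_(k, n)) (l : 'rV[R]_k) :
  certificate V l -> exists2 l', certificate V l' &
    forall x : 'rV_k, x *m V = 0 -> supp x \subset supp l' -> exists c, x = c *: l'.
Proof.
have [N] := ubnP #|supp l|; elim: N l => // N IH l ltN cl.
have [h|/existsNP[x /not_implyP[xV /not_implyP[sx xl]]]] := pselect (forall x : 'rV_k,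
  x *m V = 0 -> supp x \subset supp l -> exists c, x = c *: l); first by exists l.
have [l0 l_ge0 lV] := cl.
(* Replace [x] by [- x] if necessary; [x = 0] is excluded, being a multiple of [l]. *)
wlog [i0 xi0] : x xV sx xl / exists i, 0 < x 0 i.
  move=> wl; have [/wl|nx] := pselect (exists i, 0 < x 0 i); first exact.
  apply: (wl (- x)).
  - by rewrite mulNmx xV oppr0.
  - by apply: fintype.subset_trans sx; apply/fintype.subsetP => i; rewrite !inE mxE oppr_eq0.
  - by move=> [c xc]; apply: xl; exists (- c); rewrite scaleNr -xc opprK.
  apply: contrapT => nx'; apply: xl; exists 0; rewrite scale0r; apply/rowP => i.
  rewrite mxE; case: (ltgtP (x 0 i) 0) => // xi; last by case: nx; exists i.
  by case: nx'; exists i; rewrite mxE oppr_gt0.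
have [i1 /= xi1 i1P] := @arg_minP _ _ _ i0 (fun i => 0 < x 0 i) (fun i => l 0 i / x 0 i) xi0.
set t := l 0 i1 / x 0 i1 in i1P.
have t_ge0 : 0 <= t by rewrite divr_ge0 // ltW.
have l'i1 : (l - t *: x) 0 i1 = 0 by rewrite !mxE divfK ?subrr // gt_eqF.
have cl' : certificate V (l - t *: x).
  split=> [|i|]; last by rewrite mulmxBl -scalemxAl lV xV scaler0 subr0.
    apply/eqP => /subr0_eq lx; apply: xl; exists t^-1; rewrite lx scalerA mulVf ?scale1r //.
    by apply: contraNneq l0 => t0; rewrite lx t0 scale0r.
  rewrite !mxE subr_ge0; have [xi|xi] := leP (x 0 i) 0.
    by rewrite (le_trans _ (l_ge0 i)) // mulr_ge0_le0.
  by rewrite -ler_pdivlMr //; exact: i1P.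
apply: IH cl'; apply: (@leq_trans #|supp l|); last by rewrite -ltnS.
apply: proper_card; apply/properP; split.
  apply/fintype.subsetP => i; rewrite !inE; apply: contraNneq => li.
  have /(contra (fintype.subsetP sx i)) : i \notin supp l by rewrite inE li eqxx.
  by rewrite inE negbK !mxE li => /eqP ->; rewrite mulr0 subr0.
exists i1; last by rewrite inE l'i1 eqxx.
by apply: (fintype.subsetP sx); rewrite inE gt_eqF.
Qed.

(** Removing [i] from [I] turns row [i] into a unit row, and expansion along it leaves one
    cofactor. *)
Lemma cofactor_gram (R : realType) (k n : nat) (I : {set 'I_k}) (V : 'M[R]_(k, n)) (i : 'I_k) :
  i \in I -> cofactor (gram I V) i i = \det (gram (I :\ i) V).
Proof.
move=> iI; rewrite (expand_det_row _ i) (bigD1 i) //= big1 => [|j /negbTE ji]; last first.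
  by rewrite mxE !inE eqxx /= [i == j]eq_sym ji mul0r.
rewrite mxE !inE eqxx /= mul1r addr0 /cofactor; congr (_ * \det _).
by apply/matrixP => a b; rewrite !mxE !inE ![lift i _ == i]eq_sym !neq_lift.
Qed.

(* The kernel of the Gram matrix on a minimal support is the line of the certificate, so
   the certificate is a multiple of any nonzero row of the adjugate. *)
Lemma certificate_gram (R : realType) (k n : nat) (V : 'M[R]_(k, n)) :
  (exists l, certificate V l) <->
  exists I i, [/\ \det (gram I V) = 0, exists j, \adj (gram I V) i j != 0 &
    (forall j, 0 <= \adj (gram I V) i j) \/ (forall j, \adj (gram I V) i j <= 0)].
Proof.
have rowG (I : {set 'I_k}) i : \det (gram I V) = 0 -> row i (\adj (gram I V)) *m gram I V = 0.
  by move=> d0; rewrite -row_mul mul_adj_mx d0 -scalemx1 scale0r row0.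
split=> [[_ /minimal_certificate[l [l0 l_ge0 lV] line]]|]; last first.
  move=> [I [i [d0 [j rj] sgn]]]; have /gram_kernel[_ rV] := rowG I i d0.
  set r := row i _ in rV; have r0 : r != 0.
    apply: contraNneq rj => r0; have <- : r 0 j = \adj (gram I V) i j by rewrite mxE.
    by rewrite r0 mxE.
  case: sgn => sgn; [exists r|exists (- r)]; split=> //.
  - by move=> i'; rewrite mxE.
  - by rewrite oppr_eq0.
  - by move=> i'; rewrite mxE oppr_ge0 mxE.
  - by rewrite mulNmx rV oppr0.
have [i0 li0] : exists i, l 0 i != 0.
  apply/existsP; apply: contraNT l0 => /existsPn h; apply/eqP/rowP => i.
  by rewrite mxE; apply/eqP; rewrite -[_ == _]negbK h.
have kerl x : x *m gram (supp l) V = 0 -> exists c, x = c *: l.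
  move=> /gram_kernel[x0 xV]; apply: line => //; apply/fintype.subsetP => i; rewrite [in X in X -> _]inE.
  by apply: contraNT => /x0 ->.
have d0 : \det (gram (supp l) V) = 0.
  apply/eqP/det0P; exists l => //; apply/gram_kernel; split=> // j.
  by rewrite inE negbK => /eqP.
exists (supp l), i0; split=> //.
  (* The diagonal entry is the determinant for [supp l] without [i0]. A kernel vector there would be
     a multiple of [l] vanishing at [i0], hence zero. *)
  exists i0; rewrite mxE cofactor_gram ?inE //.
  apply/det0P => -[x x0 /gram_kernel[xout xV]]; case/eqP: x0.
  have [|c xc] := line x xV.
    apply/fintype.subsetP => i; rewrite inE => xi; have : i \in supp l :\ i0.
      by apply: contraNT xi => /xout ->.
    by rewrite in_setD1 => /andP[].
  have := xout i0; rewrite !inE eqxx xc mxE => /(_ isT)/eqP.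
  by rewrite mulf_eq0 (negbTE li0) orbF => /eqP ->; rewrite scale0r.
have [c rc] := kerl _ (rowG _ i0 d0).
have rE j : \adj (gram (supp l) V) i0 j = c * l 0 j.
  by move/rowP/(_ j): rc; rewrite !mxE.
case: (lerP 0 c) => c0; [left|right] => j; rewrite rE; first exact: mulr_ge0.
by rewrite mulr_le0_ge0 // ltW.
Qed.

(** [None] selects the determinant and [Some (i, j)] an adjugate entry. *)
Definition gram_index k := ({set 'I_k} * option ('I_k * 'I_k))%type.

Definition gram_value (R : realType) (k n : nat) (V : 'M[R]_(k, n)) (t : gram_index k) : R :=
  if t.2 is Some ij then \adj (gram t.1 V) ij.1 ij.2 else \det (gram t.1 V).

Lemma card_gram_index k : #|{: gram_index k}| = (2 ^ k * (k * k).+1)%N.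
Proof.
rewrite card_prod card_option card_prod !card_ord; congr (_ * _)%N.
by rewrite -cardsT -powersetT card_powerset cardsT card_ord.
Qed.

(** Existence of a certificate depends only on which of these values are zero, nonnegative or
    nonpositive. *)
Lemma feasible_gram_sg (R : realType) (k n : nat) (V W : 'M[R]_(k, n)) :
  (forall t, Num.sg (gram_value V t) = Num.sg (gram_value W t)) ->
  feasible V -> feasible W.
Proof.
move=> sgVW; rewrite !gordan => nV; apply: contra_not nV.
rewrite !certificate_gram => -[I [i [d0 [j rj] sgn]]]; exists I, i.
have sgadj j' : Num.sg (\adj (gram I V) i j') = Num.sg (\adj (gram I W) i j').
  exact: (sgVW (I, Some (i, j'))).
split.
- by apply/eqP; rewrite -sgr_eq0 (sgVW (I, None)) sgr_eq0 /gram_value /= d0.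
- by exists j; rewrite -sgr_eq0 sgadj sgr_eq0.
- case: sgn => sgn; [left|right] => j'.
    by rewrite -sgr_ge0 sgadj sgr_ge0.
  by rewrite -sgr_le0 sgadj sgr_le0.
Qed.

Lemma polyf_gram_value (R : realType) (m k n : nat) (V : 'rV[R]_m -> 'M[R]_(k, n))
    (t : gram_index k) :
  (forall i j, polyf 1 (fun w => V w i j)) ->
  polyf (k * 2) (fun w => gram_value (V w) t).
Proof.
move=> PV; case: t => I ij.
have PG i j : polyf 2 (fun w => gram I (V w) i j).
  case h : ((i \in I) && (j \in I)); last first.
    by apply: eq_polyf (polyf_cst _ _ (i == j)%:R) => w; rewrite mxE h.
  apply: (@eq_polyf _ _ _ (fun w => \sum_l V w i l * V w j l)).
    by move=> w; rewrite !mxE h; apply: eq_bigr => l _; rewrite mxE.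
  by apply: polyf_sum => l _; exact: polyf_mul (PV i l) (PV j l).
case: ij => [[i j]|]; last exact: polyf_det.
apply: (@eq_polyf _ _ _ (fun w => (-1) ^+ (j + i) * \det (row' j (col' i (gram I (V w)))))).
  by move=> w; rewrite /gram_value /= mxE.
apply: polyf_scale; apply: (@polyfW _ _ (k.-1 * 2)); first by rewrite leq_mul2r leq_pred.
apply: polyf_det => a b; apply: (@eq_polyf _ _ _ (fun w => gram I (V w) (lift j a) (lift i b))) => //.
by move=> w; rewrite !mxE.
Qed.

(** * The upper bound *)

Local Notation RR := Rdefinitions.R.

Lemma pdotE (k : nat) (a x : Defs.point) : pdot k a x = \sum_(j < k) a j * x j.
Proof. by elim: k => [|k IH]; rewrite ?big_ord0 // big_ord_recr /= -IH. Qed.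

(* An affine form is the row of its coefficients followed by its constant term, and a
   point is a column with homogenising last coordinate. *)
Definition affine_row (d : nat) (c : Defs.point) (c0 : RR) : 'rV[RR]_d.+1 :=
  \row_j if (j < d)%N then c j else c0.

Definition homogeneous (d : nat) (x : Defs.point) : 'cV[RR]_d.+1 :=
  \col_j if (j < d)%N then x j else 1.

Lemma affine_rowE (d : nat) (c : Defs.point) (c0 : RR) (x : Defs.point) :
  (affine_row d c c0 *m homogeneous d x) 0 0 = pdot d c x + c0.
Proof.
rewrite mxE big_ord_recr pdotE /= !mxE /= ltnn mulr1; congr (_ + _).
by apply: eq_bigr => j _; rewrite !mxE /= ltn_ord.
Qed.

Lemma homogeneousE (d : nat) (y : 'cV[RR]_d.+1) : y ord_max 0 != 0 ->
  exists x : Defs.point, y = y ord_max 0 *: homogeneous d x.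
Proof.
move=> y0; exists (fun j => y (inord j) 0 / y ord_max 0); apply/colP => j.
rewrite !mxE; case: ifPn => jd; first by rewrite mulrCA divff // mulr1 inord_val.
suff -> : j = ord_max by rewrite mulr1.
by apply/val_inj/eqP; rewrite /= eqn_leq [(d <= j)%N]leqNgt jd andbT -ltnS ltn_ord.
Qed.

(** An omitted bound becomes the constant form 1, always positive, so all prisms have matrices of
    one shape. *)
Definition bound_row (d i : nat) (e : bool) (o : option (Defs.point * RR)) : 'rV[RR]_d.+1 :=
  if o is Some (a, b) then (-1) ^+ e *: affine_row d (conormal i a) (- b)
  else affine_row d (fun=> 0) 1.

Definition prism_mx (d : nat) (s : prism) : 'M[RR]_(d + d, d.+1) :=
  \matrix_(i, j) match fintype.split i with
                 | inl i => bound_row d i false (lo s i) 0 j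
                 | inr i => bound_row d i true (Defs.up s i) 0 j
                 end.

(** The added constant row makes the homogenising coordinate positive; [h] selects a side of a
    hyperplane. *)
Definition test_mx (d : nat) (P : 'M[RR]_(d + d, d.+1)) (h : 'rV[RR]_d.+1) :
  'M[RR]_(d + d + (1 + 1), d.+1) :=
  col_mx P (col_mx (affine_row d (fun=> 0) 1) h).

Lemma pdot0 (k : nat) (x : Defs.point) : pdot k (fun=> 0) x = 0.
Proof. by rewrite pdotE big1 // => i _; rewrite mul0r. Qed.

(** A solution can be divided by its positive last coordinate. *)
Lemma feasible_test_mx (d : nat) (P : 'M[RR]_(d + d, d.+1)) (h : 'rV[RR]_d.+1) :
  feasible (test_mx P h) <-> exists x : Defs.point,
    (forall i, 0 < (P *m homogeneous d x) i 0) /\ 0 < (h *m homogeneous d x) 0 0.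
Proof.
split=> [[y]|[x [Px hx]]].
  rewrite /test_mx !mul_col_mx => yP.
  have y0 : 0 < y ord_max 0.
    have := yP (rshift _ (lshift _ 0)); rewrite col_mxEd col_mxEu mxE big_ord_recr /=.
    rewrite !mxE ltnn mul1r big1 ?add0r // => j _.
    by rewrite mxE /= ltn_ord mul0r.
  have [x yx] := homogeneousE (lt0r_neq0 y0); exists x.
  split=> [i|].
    have := yP (lshift _ i); rewrite col_mxEu yx -scalemxAr mxE.
    by rewrite pmulr_rgt0.
  have := yP (rshift _ (rshift _ 0)); rewrite !col_mxEd yx -scalemxAr mxE.
  by rewrite pmulr_rgt0.
exists (homogeneous d x) => i; rewrite /test_mx !mul_col_mx.
rewrite -[i]fintype.splitK; case: (fintype.split i) => j /=; rewrite ?col_mxEu //.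
rewrite col_mxEd -[j]fintype.splitK; case: (fintype.split j) => l /=;
  rewrite (ord1 l) ?col_mxEu ?col_mxEd //.
by rewrite affine_rowE pdot0 add0r ltr01.
Qed.

Lemma prism_mx_pos (d : nat) (s : prism) (x : Defs.point) :
  (forall i, 0 < (prism_mx d s *m homogeneous d x) i 0) <-> in_open_prism d s x.
Proof.
have rowP i : (prism_mx d s *m homogeneous d x) i 0 =
    (match fintype.split i with
     | inl i => bound_row d i false (lo s i)
     | inr i => bound_row d i true (Defs.up s i)
     end *m homogeneous d x) 0 0.
  by rewrite !mxE; apply: eq_bigr => j _; rewrite mxE; case: (fintype.split i).
have loP i : (i < d)%N -> 0 < (bound_row d i false (lo s i) *m homogeneous d x) 0 0 <->
    match lo s i with Some (a, b) => Rlt (Rplus (pdot i a x) b) (x i) | None => True end.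
  move=> ltid; rewrite /bound_row; case: (lo s i) => [[a b]|]; last first.
    by rewrite affine_rowE pdot0 add0r ltr01.
  rewrite expr0 scale1r affine_rowE pdot_conormal; last exact/ssrnat.ltP.
  by rewrite RminusE RoppE; split=> [h|/RltP]; [apply/RltP|]; rewrite RplusE; lra.
have upP i : (i < d)%N -> 0 < (bound_row d i true (Defs.up s i) *m homogeneous d x) 0 0 <->
    match Defs.up s i with Some (a, b) => Rlt (x i) (Rplus (pdot i a x) b) | None => True end.
  move=> ltid; rewrite /bound_row; case: (Defs.up s i) => [[a b]|]; last first.
    by rewrite affine_rowE pdot0 add0r ltr01.
  rewrite expr1 -scalemxAl mxE affine_rowE pdot_conormal; last exact/ssrnat.ltP.
  by rewrite RminusE RoppE; split=> [h|/RltP]; [apply/RltP|]; rewrite RplusE; lra.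
split=> [H i /ssrnat.ltP ltid|H i].
  split; [apply/(loP i ltid)|apply/(upP i ltid)].
    by have := H (lshift d (Ordinal ltid)); rewrite rowP (unsplitK (inl _)).
  by have := H (rshift d (Ordinal ltid)); rewrite rowP (unsplitK (inr _)).
rewrite rowP; case: (fintype.split i) => j; have /ssrnat.ltP/H[lo_j up_j] := ltn_ord j.
  exact/loP.
exact/upP.
Qed.

Lemma meets_interior_feasible (d : nat) (H : Defs.point -> Prop) (a : Defs.point) (b : RR)
    (s : prism) :
  (exists i, Peano.lt i d /\ a i <> 0) -> (forall x, H x <-> pdot d a x = b) ->
  meets_interior d H s <->
  forall e : bool, feasible (test_mx (prism_mx d s) ((-1) ^+ e *: affine_row d a (- b))).
Proof.
move=> a0 HP; have -> : meets_interior d H s <->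
    (exists x, pdot d a x = b /\ in_open_prism d s x).
  split=> [[x [/HP Hx /interior_prism Ix]]|[x [/HP Hx /interior_prism Ix]]]; first by exists x.
  by exists x; split.
rewrite (open_prism_meets_hyperplane d s a b a0).
have side (e : bool) : feasible (test_mx (prism_mx d s) ((-1) ^+ e *: affine_row d a (- b))) <->
    exists x, in_open_prism d s x /\ 0 < (-1) ^+ e * (pdot d a x - b).
  rewrite feasible_test_mx; split=> -[x [Px hx]]; exists x; split.
  - exact/prism_mx_pos.
  - by move: hx; rewrite -scalemxAl mxE affine_rowE.
  - exact/prism_mx_pos.
  - by rewrite -scalemxAl mxE affine_rowE.
split=> [[[x [Px hx]] [y [Py hy]]]|fe].
  case; apply/side; [exists y|exists x]; split=> //.
    by move/RltP: hy; rewrite RminusE R0E expr1; lra.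
  by move/RltP: hx; rewrite RminusE expr0 mul1r.
have /side[x [Px hx]] := fe false; have /side[y [Py hy]] := fe true.
split; [exists x|exists y]; split=> //; apply/RltP; rewrite RminusE R0E.
  by move: hx; rewrite expr0 mul1r.
by move: hy; rewrite expr1; lra.
Qed.

(** * From sign patterns to the cubic bound *)

Lemma shattered_count (d n k m : nat) (H : nat -> Defs.point -> Prop) :
  shattered d n H -> k = (d + d + (1 + 1))%N -> m = ((d + d) * d.+1)%N ->
  (2 ^ n <= (2 * (n * 2 * (2 ^ k * (k * k).+1) * 2 * (k * 2) + m * 2)).+1 ^ m)%N.
Proof.
move=> [hypH [_ Sh]] {k}-> {m}->; set k := (d + d + (1 + 1))%N; set m := ((d + d) * d.+1)%N.
have /fin_all_exists[a /fin_all_exists[b abP]] (i : 'I_n) : exists a : Defs.point, exists b : RR,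
    (exists j, Peano.lt j d /\ a j <> 0) /\ forall x, H i x <-> pdot d a x = b.
  exact/hypH/ssrnat.ltP.
have /fin_all_exists[s sP] (u : {ffun 'I_n -> bool}) : exists s : prism,
    forall i : 'I_n, meets_interior d (H i) s <-> u i.
  (* The subset is extended by [false] to indices from [n] on. *)
  have [s sP] := Sh (fun i => if insub i is Some j then u j else false).
  exists s => i; rewrite sP; last exact/ssrnat.ltP.
  by rewrite valK.
pose test (i : 'I_n) (e : bool) (w : 'rV[RR]_m) :=
  test_mx (vec_mx w) ((-1) ^+ e *: affine_row d (a i) (- b i)).
pose f (j : 'I_n * bool * gram_index k) (w : 'rV[RR]_m) :=
  gram_value (test j.1.1 j.1.2 w) j.2.
have <- : #|{: 'I_n * bool * gram_index k}| = (n * 2 * (2 ^ k * (k * k).+1))%N.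
  by rewrite card_prod card_gram_index card_prod card_ord card_bool.
have <- : #|{ffun 'I_n -> bool}| = (2 ^ n)%N by rewrite card_ffun card_bool card_ord.
(* The points are the matrices of prisms realising the [2 ^ n] subsets. Equal signs at two of them
   would give the same feasible systems, hence the same subset. *)
apply: (@sign_bound _ _ _ _ _ f (fun u => mxvec (prism_mx d (s u)))).
  move=> [[i e] t]; apply: polyf_gram_value => p q; rewrite /test /=.
  rewrite -[p]fintype.splitK; case: (fintype.split p) => p' /=.
    apply: (@eq_polyf _ _ _ (fun w => w 0 (mxvec_index p' q))); last exact: polyf_coord.
    by move=> w; rewrite col_mxEu mxE.
  by apply: eq_polyf (polyf_cst _ _ (col_mx (affine_row d (fun=> 0) 1)
    ((-1) ^+ e *: affine_row d (a i) (- b i)) p' q)) => w; rewrite col_mxEd.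
move=> u v; apply: contra_neqP => /forallNP same; apply/ffunP => i.
have {}same j : Num.sg (f j (mxvec (prism_mx d (s u)))) = Num.sg (f j (mxvec (prism_mx d (s v)))).
  by apply/eqP; have /negP := same j; rewrite negbK.
have [ai Hi] := abP i.
have step (u' v' : {ffun 'I_n -> bool}) :
    (forall j, Num.sg (f j (mxvec (prism_mx d (s u')))) = Num.sg (f j (mxvec (prism_mx d (s v'))))) ->
    u' i -> v' i.
  move=> eq_sg /sP/(meets_interior_feasible (s u') ai Hi) fe; apply/sP.
  apply/(meets_interior_feasible (s v') ai Hi) => e; apply: feasible_gram_sg (fe e) => t.
  by have := eq_sg (i, e, t); rewrite /f /test /= !mxvecK.
by apply/idP/idP; apply: step.
Qed.

Lemma shattered_exp_bound (d n : nat) (H : nat -> Defs.point -> Prop) :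
  (0 < d)%N -> (0 < n)%N -> shattered d n H ->
  (2 ^ n <= (n * 2 ^ (21 * d)) ^ (4 * (d * d)))%N.
Proof.
move=> d0 n0 /shattered_count-/(_ _ _ erefl erefl); set k := (d + d + (1 + 1))%N.
have kd : (k <= 4 * d)%N by rewrite /k; lia.
set m := ((d + d) * d.+1)%N.
have mk : (4 * m < 2 * (k * k))%N by rewrite /m /k; nia.
have mle : (m <= 4 * (d * d))%N by rewrite /m; nia.
set X := (X in (X ^ m)%N)  => /leq_trans; apply.
have k2 : (k.+1 <= 2 ^ k)%N by rewrite ltn_expl.
have kk : ((k * k).+1 <= 2 ^ k * 2 ^ k)%N by apply: leq_trans (leq_mul k2 k2); nia.
have XE : (X <= n * 2 ^ (21 * d))%N.
  (* With [k = 2d + 2] the exponent is [8d + 13], at most [21d] because [d >= 1]. *)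
  apply: (@leq_trans (n * 2 ^ (4 * k + 5))%N); last first.
    by rewrite leq_mul2l leq_exp2l // orbC; apply/orP; left; rewrite /k; lia.
  have -> : (2 ^ (4 * k + 5) = 32 * (2 ^ k * 2 ^ k * (2 ^ k * 2 ^ k)))%N.
    by rewrite expnD mulnC mulSn !expnD !mulSn !mul0n; lia.
  set P := (2 ^ k)%N in k2 kk *.
  have X1 : (X <= 16 * n * (k * P * (k * k).+1) + 2 * (k * k))%N by rewrite /X; nia.
  apply: leq_trans X1 _.
  have X2 : (k * P * (k * k).+1 <= P * P * (P * P))%N.
    by apply: leq_mul kk; rewrite leq_mul2r (ltnW k2) orbT.
  have X3 : (2 * (k * k) <= 16 * n * (P * P * (P * P)))%N.
    have : (k * k <= P * P * (P * P))%N by apply: leq_trans (ltnW kk) _; nia.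
    by move: n0; set Q := (_ * _ * _)%N; nia.
  by move: X2 X3; set Q := (P * P * (P * P))%N; set Y := (k * P * _)%N; nia.
apply: (@leq_trans ((n * 2 ^ (21 * d)) ^ m)%N).
  by rewrite leq_exp2r // /m muln_gt0 addn_gt0 d0.
by rewrite leq_pexp2l // muln_gt0 n0 expn_gt0.
Qed.

(** With [D] the cube of [d], [q] the quotient of [n] by [D] and [l] its logarithmic size, the
    exponential bound yields [q <= 4l + 96], while [2 ^ (l - 1) <= q + 1]. Hence [l <= 8] and
    [q + 1 <= 129]. *)
Lemma upper_bound (d n : nat) (H : nat -> Defs.point -> Prop) :
  Peano.le 1 d -> shattered d n H -> Peano.le n (Nat.mul 129 (Nat.pow d 3)).
Proof.
move=> /ssrnat.leP d0 Sh; apply/ssrnat.leP.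
rewrite (_ : Nat.pow d 3 = (d * (d * d))%N); last by rewrite /Nat.pow multE muln1.
change (n <= 129 * (d * (d * d)))%N; have [->//|n0] := posnP n.
have := shattered_exp_bound d0 n0 Sh.
set D := (d * (d * d))%N; have D0 : (0 < D)%N by rewrite !muln_gt0 d0.
set q := (n %/ D)%N; set l := (trunc_log 2 q.+1).+1.
have lt_q : (q.+1 < 2 ^ l)%N by apply: trunc_log_ltn.
have ge_q : (2 ^ l.-1 <= q.+1)%N by apply: trunc_logP.
have nD : (n < q.+1 * D)%N by rewrite /q; exact: ltn_ceil.
have qD : (q * D <= n)%N by rewrite /q; exact: leq_trunc_div.
have D2 : (D <= 2 ^ (3 * d))%N.
  have d2 : (d <= 2 ^ d)%N by rewrite ltnW // ltn_expl.
  have -> : (2 ^ (3 * d) = 2 ^ d * (2 ^ d * 2 ^ d))%N by rewrite -!expnD; congr (_ ^ _)%N; lia.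
  by rewrite !leq_mul.
have n2 : (n <= 2 ^ (l + 3 * d))%N.
  by rewrite expnD; apply: leq_trans (ltnW nD) _; apply: leq_mul => //; exact: ltnW.
have base : (n * 2 ^ (21 * d) <= 2 ^ (l + 24 * d))%N.
  have -> : (l + 24 * d = (l + 3 * d) + 21 * d)%N by lia.
  by rewrite expnD leq_mul2r n2 orbT.
move=> le1; have le2 : (n <= (l + 24 * d) * (4 * (d * d)))%N.
  rewrite -(leq_exp2l (m := 2)) // (leq_trans le1) // [X in (_ <= X)%N]expnM leq_exp2r //.
  by rewrite !muln_gt0 d0.
have q_le : (q <= 4 * l + 96)%N.
  have : (q * D <= (4 * l + 96) * D)%N.
    apply: leq_trans qD (leq_trans le2 _); rewrite /D; nia.
  by rewrite leq_mul2r => /orP[/eqP D0'|//]; rewrite D0' in D0.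
have l_le : (l <= 8)%N.
  rewrite leqNgt; apply/negP => l9.
  (* For [l >= 9] the value [2 ^ (l - 1)] already exceeds [4l + 97]. *)
  have grow j : (4 * (9 + j) + 97 < 2 ^ (8 + j))%N.
    by elim: j => [//|j IH]; rewrite !addnS expnS; lia.
  have := grow (l - 9)%N; rewrite subnKC //.
  have -> : (8 + (l - 9) = l.-1)%N by lia.
  by move: ge_q q_le; lia.
have : (q.+1 <= 129)%N by lia.
by move=> q129; apply: leq_trans (ltnW nD) _; rewrite leq_mul2r q129 orbT.
Qed.

End Upper.

Theorem theoremv :
  exists C : nat, forall d : nat, (1 <= d)%nat ->
    (exists H : nat -> point -> Prop,
        shattered d (1 + d * (d + 1) / 2)%nat H) /\
    (forall (n : nat) (H : nat -> point -> Prop),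
        shattered d n H -> (n <= C * d ^ 3)%nat).
Proof.
  exists 129%nat. intros d Hd. split.
  - exists (test_hyperplane d). exact (lower_bound d Hd).
  - intros n H Sh. exact (Upper.upper_bound Hd Sh).
Qed.
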